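(* (Noncommutative Chern-Weil homomorphism.) Let $k$ be a field, $C$ a $k$-coalgebra with a group-like element $e$, $B\subseteq A$ a $C$-Galois extension with invertible canonical entwining, and $\ell:C\to A\otimes A$, $\ell(c)=c^{\langle1\rangle}\otimes c^{\langle2\rangle}$, a strong connection. Let $M=A\,\Box^CA$ with the multiplication $x\cdot y=\varepsilon(x)y$, where $\varepsilon(\sum a\otimes a')=\sum aa'$. For $c\in C^{\mathrm{tr}}$ and $m\ge0$ put $$\mathrm c_m(\ell)(c)=\bigl(c_{(m+1)}^{\langle2\rangle}\otimes c_{(1)}^{\langle1\rangle}\bigr)\otimes\bigl(c_{(1)}^{\langle2\rangle}\otimes c_{(2)}^{\langle1\rangle}\bigr)\otimes\cdots\otimes\bigl(c_{(m)}^{\langle2\rangle}\otimes c_{(m+1)}^{\langle1\rangle}\bigr)\in M^{\otimes(m+1)}.$$ Then for any $c\in C^{\mathrm{tr}}$ and $n\ge0$, $$\widetilde{\mathrm{chw}}_n(\ell,c):=\sum_{m=0}^{2n}(-1)^{\lfloor m/2\rfloor}\frac{m!}{\lfloor m/2\rfloor!}\,\mathrm c_m(\ell)(c)$$ is a $2n$-cycle in the total complex $\mathrm{Tot}\,\mathrm{CC}_\bullet(M)=\bigoplus_{m=0}^{\bullet}M^{\otimes(m+1)}$ computing the cyclic homology $\mathrm{HC}_\bullet(M)$. Its homology class is stable under Connes' periodicity operator $S$, i.e. $S[\widetilde{\mathrm{chw}}_n(\ell,c)]=[\widetilde{\mathrm{chw}}_{n-1}(\ell,c)]$ for $n\ge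1$.
   Context: Tensor products without subscript are over $k$. $A$ is a unital $k$-algebra and a right $C$-comodule with coaction $\rho(a)=a_{(0)}\otimes a_{(1)}$, and $B=\{b\in A: b_{(0)}\otimes b_{(1)}=b\otimes e\}$ is a unital subalgebra with $\rho$ left $B$-linear. $B\subseteq A$ is a $C$-Galois extension if $\mathrm{can}:A\otimes_BA\to A\otimes C$, $a\otimes_Ba'\mapsto aa'_{(0)}\otimes a'_{(1)}$, is bijective. The canonical entwining is $\psi:C\otimes A\to A\otimes C$, $\psi(c\otimes a)=\mathrm{can}(\mathrm{can}^{-1}(1\otimes c)a)$; it is assumed bijective. $A$ is a left $C$-comodule via $a\mapsto a_{(-1)}\otimes a_{(0)}:=\psi^{-1}(a\otimes e)$. The translation map is $\tau:C\to A\otimes_BA$, $\tau(c)=\mathrm{can}^{-1}(1\otimes c)$. A strong connection is a linear map $\ell:C\to A\otimes A$ with $\ell(e)=1\otimes1$, which is $C$-bicolinear (for the left coaction on the first tensorand $A$ and the right coaction on the second one) and whose composite with $A\otimes A\to A\otimes_BA$ equals $\tau$. $M=A\,\Box^CA$ is the space of $\sum a\otimes a'\in A\otimes A$ with $\sum a_{(0)}\otimes a_{(1)}\otimes a'=\sum a\otimes a'_{(-1)}\otimes a'_{(0)}$; it is a left $B$-module via $b(a\otimes a')=ba\otimes a'$, and $\varepsilon$ is a left $B$-linear map $M\to B$. $C^{\mathrm{tr}}=\{c\in C: c_{(1)}\otimes c_{(2)}=c_{(2)}\otimes c_{(1)}\}$. For a possibly nonunital $k$-algebra $R$, $\mathrm{CC}(R)$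 is the first-quadrant bicomplex with $R^{\otimes(q+1)}$ in column $p\ge0$, row $q\ge0$, vertical differential $b$ in even columns and $-b'$ in odd columns, horizontal differential $1-t$ from odd columns and $N$ from even columns of index $\ge2$, each to the preceding column. Here, on $R^{\otimes(n+1)}$, $b'(r^0\otimes\cdots\otimes r^n)=\sum_{i=0}^{n-1}(-1)^ir^0\otimes\cdots\otimes r^ir^{i+1}\otimes\cdots\otimes r^n$, $b=b'+(-1)^n(r^0\otimes\cdots\otimes r^n\mapsto r^nr^0\otimes r^1\otimes\cdots\otimes r^{n-1})$, $t(r^0\otimes\cdots\otimes r^n)=(-1)^nr^n\otimes r^0\otimes\cdots\otimes r^{n-1}$, $N=\sum_{i=0}^nt^i$. In $\mathrm{Tot}\,\mathrm{CC}_{n}(R)$ the summand $R^{\otimes(m+1)}$ is in column $n-m$. $\mathrm{HC}_\bullet(R)$ is the homology of $\mathrm{Tot}\,\mathrm{CC}(R)$, and $S:\mathrm{HC}_n(R)\to\mathrm{HC}_{n-2}(R)$ is induced by the quotient by the first two columns, identified with a shift of $\mathrm{CC}(R)$. *)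

(* Defs.v *)
From HB Require Import structures.
From mathcomp Require Import all_boot ssralg generic_quotient boolp.
From mathcomp.multinomials Require Import freeg.

Set Implicit Arguments.
Unset Strict Implicit.
Unset Printing Implicit Defensive.

Import GRing.Theory.
Local Open Scope ring_scope.
Local Open Scope quotient_scope.

Section LinearMaps.
Variable k : fieldType.
Implicit Types U V W : lmodType k.

Definition linfn V W (f : V -> W) of linear f : V -> W := f.
HB.instance Definition _ V W (f : V -> W) (hf : linear f) :=
  GRing.isLinear.Build k V W _ (linfn hf) hf.

Definition mklin V W (f : V -> W) (hf : linear f) : {linear V -> W} :=
  [the {linear V -> W} of linfn hf].

Lemma mklinE V W (f : V -> W) (hf : linear f) : mklin hf =1 f.
Proof. by []. Qed.

Definition lid V : {linear V -> V} := [the {linear V -> V} of idfun].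

Definition lcomp U V W (g : {linear V -> W}) (f : {linear U -> V}) :
  {linear U -> W} := [the {linear U -> W} of g \o f].

Lemma lidE V (v : V) : lid V v = v. Proof. by []. Qed.

Lemma lcompE U V W (g : {linear V -> W}) (f : {linear U -> V}) u :
  lcomp g f u = g (f u).
Proof. by []. Qed.

Lemma bij_surj V W (f : {linear V -> W}) (hf : bijective f) (w : W) :
  exists v, f v = w.
Proof. by case: hf => g _ gK; exists (g w). Qed.

Definition linv_fun V W (f : {linear V -> W}) (hf : bijective f) (w : W) : V :=
  proj1_sig (cid (bij_surj hf w)).

Lemma linv_funK V W (f : {linear V -> W}) (hf : bijective f) :
  cancel (linv_fun hf) f.
Proof. by move=> w; rewrite /linv_fun; case: cid. Qed.

Lemma linv_fun_linear V W (f : {linear V -> W}) (hf : bijective f) :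
  linear (linv_fun hf).
Proof.
move=> a u v; apply: (bij_inj hf).
by rewrite linearP !linv_funK.
Qed.

Definition linv V W (f : {linear V -> W}) (hf : bijective f) :
  {linear W -> V} := mklin (linv_fun_linear hf).

Lemma linvK V W (f : {linear V -> W}) (hf : bijective f) : cancel (linv hf) f.
Proof. exact: linv_funK. Qed.

Lemma linvKV V W (f : {linear V -> W}) (hf : bijective f) : cancel f (linv hf).
Proof. by move=> v; apply: (bij_inj hf); rewrite linvK. Qed.

End LinearMaps.
Arguments linfn {k V W f} hf _ : simpl never.

Notation "g ∘ f" := (lcomp g f) (at level 50, left associativity) : ring_scope.

(* Equalizer of two linear maps, as a subspace of their source. *)
Section Equalizer.
Variables (k : fieldType) (V W : lmodType k) (f g : {linear V -> W}).

Definition eqz_pred : {pred V} := fun x => f x == g x.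

Lemma eqz_submod : submod_closed eqz_pred.
Proof.
split; first by rewrite unfold_in !linear0.
by move=> a u v; rewrite !unfold_in => /eqP eu /eqP ev; rewrite !linearP eu ev.
Qed.

HB.instance Definition _ := GRing.isSubmodClosed.Build k V eqz_pred eqz_submod.

Record equalizer := Equalizer { eqz_val : V; _ : eqz_val \in eqz_pred }.

HB.instance Definition _ := [isSub for eqz_val].
HB.instance Definition _ := [Choice of equalizer by <:].
HB.instance Definition _ := [SubChoice_isSubLmodule of equalizer by <:].

Lemma equalizerP (x : equalizer) : f (val x) = g (val x).
Proof. exact/eqP/(valP x). Qed.

Definition eqz_mk (x : V) (hx : f x = g x) : equalizer :=
  @Equalizer x (introT eqP hx).

Definition eqz_incl : {linear equalizer -> V} := [the {linear _ -> _} of val].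

End Equalizer.

(* Quotient of V by the subspace spanned by G. *)
Section Quotient.
Variables (k : fieldType) (V : lmodType k) (G : V -> Prop).

Inductive span : V -> Prop :=
| span0 : span 0
| spanS a g v : G g -> span v -> span (a *: g + v).

Lemma spanD u v : span u -> span v -> span (u + v).
Proof.
by elim=> [|a g u' Gg _ IH] hv; rewrite ?add0r // -addrA; apply/spanS/IH.
Qed.

Lemma spanZ a v : span v -> span (a *: v).
Proof.
elim=> [|b g u' Gg _ IH]; first by rewrite scaler0; apply: span0.
by rewrite scalerDr scalerA; apply: spanS.
Qed.

Lemma spanN v : span v -> span (- v).
Proof. by move=> /(spanZ (-1)); rewrite scaleN1r. Qed.

Lemma span_gen v : G v -> span v.
Proof. by move=> Gv; rewrite -[v]addr0 -[v]scale1r; apply/spanS/span0. Qed.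

Definition quot_eqv : rel V := fun u v => `[< span (u - v) >].

Lemma quot_eqvP u v : reflect (span (u - v)) (quot_eqv u v).
Proof. exact: asboolP. Qed.

Lemma quot_eqv_refl : reflexive quot_eqv.
Proof. by move=> v; apply/quot_eqvP; rewrite subrr; apply: span0. Qed.
Lemma quot_eqv_sym : symmetric quot_eqv.
Proof. by move=> u v; apply/quot_eqvP/quot_eqvP => /spanN; rewrite opprB. Qed.
Lemma quot_eqv_trans : transitive quot_eqv.
Proof.
move=> v u w /quot_eqvP huv /quot_eqvP hvw; apply/quot_eqvP.
by rewrite -(subrKA v); apply: spanD.
Qed.

Canonical quot_equiv := EquivRel quot_eqv quot_eqv_refl quot_eqv_sym quot_eqv_trans.

Definition quotmod := {eq_quot quot_equiv}.
HB.instance Definition _ := Choice.on quotmod.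
HB.instance Definition _ := EqQuotient.on quotmod.

Lemma quot_eqP u v : \pi_quotmod u = \pi_quotmod v <-> span (u - v).
Proof. by split=> [/eqmodP /quot_eqvP | h] //; apply/eqmodP/quot_eqvP. Qed.

Definition quot_zero : quotmod := \pi_quotmod 0.
Definition quot_opp (x : quotmod) : quotmod := \pi_quotmod (- repr x).
Definition quot_add (x y : quotmod) : quotmod := \pi_quotmod (repr x + repr y).
Definition quot_scale (a : k) (x : quotmod) : quotmod := \pi_quotmod (a *: repr x).

Lemma span_repr v : span (repr (\pi_quotmod v) - v).
Proof. by apply/quot_eqP; rewrite reprK. Qed.

Lemma quot_opp_pi v : quot_opp (\pi v) = \pi_quotmod (- v).
Proof. by apply/quot_eqP; rewrite -opprD; apply/spanN/span_repr. Qed.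
Lemma quot_add_pi u v : quot_add (\pi u) (\pi v) = \pi_quotmod (u + v).
Proof. by apply/quot_eqP; rewrite opprD addrACA; apply: spanD; apply: span_repr. Qed.
Lemma quot_scale_pi a v : quot_scale a (\pi v) = \pi_quotmod (a *: v).
Proof. by apply/quot_eqP; rewrite -scalerBr; apply/spanZ/span_repr. Qed.

Lemma quot_addA : associative quot_add.
Proof.
elim/quotW=> u; elim/quotW=> v; elim/quotW=> w.
by rewrite !quot_add_pi addrA.
Qed.
Lemma quot_addC : commutative quot_add.
Proof. by elim/quotW=> u; elim/quotW=> v; rewrite !quot_add_pi addrC. Qed.
Lemma quot_add0 : left_id quot_zero quot_add.
Proof. by elim/quotW=> u; rewrite quot_add_pi add0r. Qed.
Lemma quot_addN : left_inverse quot_zero quot_opp quot_add.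
Proof. by elim/quotW=> u; rewrite quot_opp_pi quot_add_pi addNr. Qed.

HB.instance Definition _ :=
  GRing.isZmodule.Build quotmod quot_addA quot_addC quot_add0 quot_addN.

Lemma quot_scaleA a b x : quot_scale a (quot_scale b x) = quot_scale (a * b) x.
Proof. by elim/quotW: x => u; rewrite !quot_scale_pi scalerA. Qed.
Lemma quot_scale1 : left_id 1 quot_scale.
Proof. by elim/quotW=> u; rewrite quot_scale_pi scale1r. Qed.
Lemma quot_scaleDr : right_distributive quot_scale +%R.
Proof.
move=> a x y.
change (quot_scale a (quot_add x y) = quot_add (quot_scale a x) (quot_scale a y)).
elim/quotW: x => u; elim/quotW: y => v.
by rewrite quot_add_pi !quot_scale_pi quot_add_pi scalerDr.
Qed.
Lemma quot_scaleDl x : {morph quot_scale^~ x : a b / a + b}.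
Proof.
move=> a b.
change (quot_scale (a + b) x = quot_add (quot_scale a x) (quot_scale b x)).
elim/quotW: x => u.
by rewrite !quot_scale_pi quot_add_pi scalerDl.
Qed.

HB.instance Definition _ := GRing.Zmodule_isLmodule.Build k quotmod
  quot_scaleA quot_scale1 quot_scaleDr quot_scaleDl.

Lemma qpi_linear : linear \pi_quotmod.
Proof.
move=> a u v.
change (\pi_quotmod (a *: u + v) =
  quot_add (quot_scale a (\pi_quotmod u)) (\pi_quotmod v)).
by rewrite quot_scale_pi quot_add_pi.
Qed.

Definition qpi : {linear V -> quotmod} := mklin qpi_linear.

Lemma qpi_eq0 v : qpi v = 0 <-> span v.
Proof.
rewrite -[X in span X]subr0; apply: iff_trans (quot_eqP v 0).
by rewrite -[\pi_quotmod v]/(qpi v) -[\pi_quotmod 0]/(qpi 0) linear0.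
Qed.

Lemma qpi_surj x : exists v, x = qpi v.
Proof. by elim/quotW: x => v; exists v. Qed.

Section Lift.
Variables (W : lmodType k) (f : {linear V -> W}) (hf : forall g, G g -> f g = 0).

Lemma lift_span v : span v -> f v = 0.
Proof.
elim=> [|a g u Gg _ IH]; first exact: linear0.
by rewrite linearP hf // scaler0 add0r IH.
Qed.

Definition qlift_fun (x : quotmod) : W := f (repr x).

Lemma qlift_fun_pi v : qlift_fun (qpi v) = f v.
Proof.
by apply/eqP; rewrite -subr_eq0 -linearB; apply/eqP/lift_span/span_repr.
Qed.

Lemma qlift_fun_linear : linear qlift_fun.
Proof.
move=> a x y; have [u ->] := qpi_surj x; have [v ->] := qpi_surj y.
by rewrite -linearP !qlift_fun_pi linearP.
Qed.

Definition qlift : {linear quotmod -> W} := mklin qlift_fun_linear.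

Lemma qliftE v : qlift (qpi v) = f v.
Proof. exact: qlift_fun_pi. Qed.

End Lift.
End Quotient.

(* The tensor product over k, with its universal property; it is constructed
   in FreeTensor as the free vector space on V * W modulo bilinearity, and
   sealed so that only the fields below are visible. *)
Record tensor_product (k : fieldType) (V W : lmodType k) := TensorProduct {
  tp_sort : lmodType k;
  tp_pure : V -> W -> tp_sort;
  tp_linearl : forall w, linear (tp_pure^~ w);
  tp_linearr : forall v, linear (tp_pure v);
  tp_ind : forall P : tp_sort -> Prop, P 0 ->
    (forall a v w x, P x -> P (a *: tp_pure v w + x)) -> forall x, P x;
  tp_lift : forall (U : lmodType k) (f : V -> W -> U),
    (forall w, linear (f^~ w)) -> (forall v, linear (f v)) ->
    {linear tp_sort -> U};
  tp_liftE : forall U f fl fr v w,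
    @tp_lift U f fl fr (tp_pure v w) = f v w
}.

Module FreeTensor.
Section FreeTensor.
Variables (k : fieldType).

Section Def.
Variables V W : lmodType k.
Implicit Types (v : V) (w : W).

Let gen v w : {freeg (V * W)%type / k} := << (v, w) >>.

Inductive tens_rel : {freeg (V * W)%type / k} -> Prop :=
| tens_rell a v v' w :
    tens_rel (gen (a *: v + v') w - (a *: gen v w + gen v' w))
| tens_relr a v w w' :
    tens_rel (gen v (a *: w + w') - (a *: gen v w + gen v w')).

Definition tens := quotmod tens_rel.
HB.instance Definition _ := GRing.Lmodule.on tens.

Definition tpure v w : tens := qpi tens_rel << (v, w) >>.

Lemma tpure_linearl w : linear (tpure^~ w).
Proof.
move=> a v v'; rewrite /tpure -linearP; apply/quot_eqP/span_gen.
exact: tens_rell.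
Qed.

Lemma tpure_linearr v : linear (tpure v).
Proof.
move=> a w w'; rewrite /tpure -linearP; apply/quot_eqP/span_gen.
exact: tens_relr.
Qed.

Lemma tens_ind (P : tens -> Prop) : P 0 ->
  (forall a v w x, P x -> P (a *: tpure v w + x)) -> forall x, P x.
Proof.
move=> P0 PD x; have [g ->] := qpi_surj x.
rewrite -[g]freeg_sumE linear_sum /=.
elim: (dom g) => [|z s IH]; first by rewrite big_nil.
rewrite big_cons; have -> : << coeff z g *g z >> = coeff z g *: << z >>.
  by apply/eqP/freeg_eqP => y; rewrite coeffZ !coeffU mul1r.
by rewrite linearZ /=; case: z => v w; apply: PD.
Qed.

Section Lift.
Variables (U : lmodType k) (f : V -> W -> U).
Hypotheses (fl : forall w, linear (f^~ w)) (fr : forall v, linear (f v)).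

Definition tlift_free : {freeg (V * W)%type / k} -> U :=
  fglift (fun p => f p.1 p.2).

HB.instance Definition _ :=
  GRing.isZmodMorphism.Build {freeg (V * W)%type / k} U tlift_free
    (lift_is_additive _).

Lemma tlift_free_linear : linear tlift_free.
Proof.
move=> a x y; rewrite raddfD; congr (_ + _).
rewrite -[in LHS](freeg_sumE x) -[in RHS](freeg_sumE x) scaler_sumr !raddf_sum.
apply: eq_bigr => z _ /=.
have -> : a *: << coeff z x *g z >> = << a * coeff z x *g z >>.
  by apply/eqP/freeg_eqP => t; rewrite coeffZ !coeffU mulrA.
by rewrite /tlift_free !liftU scalerA.
Qed.

Lemma tlift_rel g : tens_rel g -> mklin tlift_free_linear g = 0.
Proof.
by case=> *; rewrite linearB linearP !mklinE /tlift_free !liftU !scale1r /= ?fl ?fr subrr.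
Qed.

Definition tlift : {linear tens -> U} := qlift tlift_rel.

Lemma tliftE v w : tlift (tpure v w) = f v w.
Proof. by rewrite /tlift qliftE mklinE /tlift_free liftU scale1r. Qed.

End Lift.
End Def.
End FreeTensor.
End FreeTensor.

Section Tensor.
Variable k : fieldType.

Fact tens_key : unit. Proof. exact: tt. Qed.

Definition tens_pack (V W : lmodType k) : tensor_product V W :=
  locked_with tens_key
    (TensorProduct (@FreeTensor.tpure_linearl k V W)
       (@FreeTensor.tpure_linearr k V W) (@FreeTensor.tens_ind k V W)
       (@FreeTensor.tliftE k V W)).

Variables V W : lmodType k.

Definition tens : lmodType k := tp_sort (tens_pack V W).
Definition tpure (v : V) (w : W) : tens := tp_pure (tens_pack V W) v w.

Lemma tpure_linearl w : linear (tpure^~ w). Proof. exact: tp_linearl. Qed.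
Lemma tpure_linearr v : linear (tpure v). Proof. exact: tp_linearr. Qed.

Lemma tens_ind (P : tens -> Prop) : P 0 ->
  (forall a v w x, P x -> P (a *: tpure v w + x)) -> forall x, P x.
Proof. exact: tp_ind. Qed.

Lemma tens_ext (U : lmodType k) (f g : {linear tens -> U}) :
  (forall v w, f (tpure v w) = g (tpure v w)) -> f =1 g.
Proof.
move=> fg; elim/tens_ind => [|a v w x IH]; first by rewrite !linear0.
by rewrite !linearP fg IH.
Qed.

Definition tlift (U : lmodType k) (f : V -> W -> U)
  (fl : forall w, linear (f^~ w)) (fr : forall v, linear (f v)) :
  {linear tens -> U} := tp_lift (tens_pack V W) fl fr.

Lemma tliftE (U : lmodType k) (f : V -> W -> U) fl fr v w :
  @tlift U f fl fr (tpure v w) = f v w.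
Proof. exact: tp_liftE. Qed.

End Tensor.

Notation "V ⊗ W" := (tens V W) (at level 40, left associativity) : type_scope.
Notation "v \ot w" := (tpure v w) (at level 40, left associativity) : ring_scope.

Section TensorMaps.
Variable k : fieldType.
Implicit Types U V W : lmodType k.

Lemma tmap_linl V V' W W' (f : {linear V -> V'}) (g : {linear W -> W'}) w :
  linear (fun v => f v \ot g w).
Proof. by move=> a u v; rewrite linearP tpure_linearl. Qed.
Lemma tmap_linr V V' W W' (f : {linear V -> V'}) (g : {linear W -> W'}) v :
  linear (fun w => f v \ot g w).
Proof. by move=> a u w; rewrite linearP tpure_linearr. Qed.

Definition tmap V V' W W' (f : {linear V -> V'}) (g : {linear W -> W'}) :
  {linear V ⊗ W -> V' ⊗ W'} := tlift (tmap_linl f g) (tmap_linr f g).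

Lemma tmapE V V' W W' (f : {linear V -> V'}) (g : {linear W -> W'}) v w :
  tmap f g (v \ot w) = f v \ot g w.
Proof. exact: tliftE. Qed.

Definition tswap V W : {linear V ⊗ W -> W ⊗ V} :=
  tlift (fun w => tpure_linearr w) (fun v => tpure_linearl v).

Lemma tswapE V W (v : V) (w : W) : tswap V W (v \ot w) = w \ot v.
Proof. exact: tliftE. Qed.

Definition tpurel U V (u : U) : {linear V -> U ⊗ V} := mklin (tpure_linearr u).
Definition tpurer U V (v : V) : {linear U -> U ⊗ V} := mklin (tpure_linearl v).

Lemma tpurelE U V (u : U) (v : V) : tpurel V u v = u \ot v.
Proof. by []. Qed.
Lemma tpurerE U V (u : U) (v : V) : tpurer U v u = u \ot v.
Proof. by []. Qed.

Lemma tassoc_linl U V W (w : W) :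
  linear (fun x : U ⊗ V => tmap (lid U) (tpurer V w) x).
Proof. by move=> a x y; rewrite linearP. Qed.
Lemma tassoc_linr U V W (x : U ⊗ V) :
  linear (fun w : W => tmap (lid U) (tpurer V w) x).
Proof.
move=> a w w'; elim/tens_ind: x => [|b u v x IH].
  by rewrite !linear0 ?scaler0 addr0.
rewrite !linearP IH !tmapE /= /linfn tpure_linearr.
by rewrite tpure_linearr !scalerDr !scalerA [b * a]mulrC addrACA.
Qed.

Definition tassoc U V W : {linear (U ⊗ V) ⊗ W -> U ⊗ (V ⊗ W)} :=
  tlift (@tassoc_linl U V W) (@tassoc_linr U V W).

Lemma tassocE U V W (u : U) (v : V) (w : W) :
  tassoc U V W ((u \ot v) \ot w) = u \ot (v \ot w).
Proof. by rewrite tliftE tmapE. Qed.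

Fact tassocV_key : unit. Proof. exact: tt. Qed.
Definition tassocV U V W : {linear U ⊗ (V ⊗ W) -> (U ⊗ V) ⊗ W} :=
  locked_with tassocV_key
    (tswap _ _ ∘ tmap (lid W) (tswap _ _) ∘ tassoc W V U
      ∘ tmap (tswap _ _) (lid U) ∘ tswap _ _).

Lemma tassocVE U V W (u : U) (v : V) (w : W) :
  tassocV U V W (u \ot (v \ot w)) = (u \ot v) \ot w.
Proof. by rewrite /tassocV unlock /= !(tswapE, tmapE, tassocE). Qed.

Lemma tmap_assoc U U' V V' W W' (f : {linear U -> U'}) (g : {linear V -> V'})
    (h : {linear W -> W'}) x :
  tassoc _ _ _ (tmap (tmap f g) h x) = tmap f (tmap g h) (tassoc _ _ _ x).
Proof.
rewrite -[LHS]/((tassoc _ _ _ ∘ tmap (tmap f g) h) x).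
rewrite -[RHS]/((tmap f (tmap g h) ∘ tassoc _ _ _) x); move: x.
apply: tens_ext => y w; rewrite !lcompE.
elim/tens_ind: y => [|a u v y IH].
  by rewrite -![0 \ot w]/(tpurer _ w 0) !linear0.
rewrite -![(_ + y) \ot w]/(tpurer _ w _) !linearP !tpurerE IH.
by rewrite !tmapE !tassocE !tmapE.
Qed.

Lemma tscale_linl V (v : V) : linear (fun a : k^o => (a : k) *: v).
Proof. by move=> a b c; rewrite scalerDl scalerA. Qed.
Lemma tscale_linr V (a : k^o) : linear (fun v : V => (a : k) *: v).
Proof. by move=> b u v; rewrite scalerDr !scalerA mulrC. Qed.

(* The identifications k ⊗ V = V = V ⊗ k. *)
Definition tscalel V : {linear k^o ⊗ V -> V} :=
  tlift (@tscale_linl V) (@tscale_linr V).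
Definition tscaler V : {linear V ⊗ k^o -> V} := tscalel V ∘ tswap _ _.

Lemma tscalelE V (a : k^o) (v : V) : tscalel V (a \ot v) = (a : k) *: v.
Proof. exact: tliftE. Qed.
Lemma tscalerE V (a : k^o) (v : V) : tscaler V (v \ot a) = (a : k) *: v.
Proof. by rewrite /= tswapE tscalelE. Qed.

End TensorMaps.
Arguments tswap {k V W}.
Arguments tassoc {k U V W}.
Arguments tassocV {k U V W}.
Arguments tscalel {k V}.
Arguments tscaler {k V}.
Arguments lid {k V}.

Record coalgebra (k : fieldType) := Coalgebra {
  coalg_sort :> lmodType k;
  comul : {linear coalg_sort -> coalg_sort ⊗ coalg_sort};
  counit : {linear coalg_sort -> k^o};
  comulA : forall c,
    tassoc (tmap comul lid (comul c)) = tmap lid comul (comul c);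
  counitl : forall c, tscalel (tmap counit lid (comul c)) = c;
  counitr : forall c, tscaler (tmap lid counit (comul c)) = c
}.

Definition grouplike (k : fieldType) (C : coalgebra k) (e : C) : Prop :=
  comul C e = e \ot e /\ counit C e = 1.

Definition Ctr (k : fieldType) (C : coalgebra k) (c : C) : Prop :=
  tswap (comul C c) = comul C c.

Section Mul.
Variables (k : fieldType) (A : algType k).

Lemma lmul_linear (a : A) : linear ( *%R a).
Proof. by move=> x u v; rewrite mulrDr scalerAr. Qed.
Lemma rmul_linear (a : A) : linear ( *%R^~ a).
Proof. by move=> x u v; rewrite mulrDl scalerAl. Qed.

Definition lmul (a : A) : {linear A -> A} := mklin (lmul_linear a).
Definition rmul (a : A) : {linear A -> A} := mklin (rmul_linear a).
Definition tmul : {linear A ⊗ A -> A} := tlift rmul_linear lmul_linear.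

Lemma lmulE a b : lmul a b = a * b. Proof. by []. Qed.
Lemma rmulE a b : rmul a b = b * a. Proof. by []. Qed.

Lemma tmulE a a' : tmul (a \ot a') = a * a'.
Proof. exact: tliftE. Qed.

End Mul.

Definition coinvariant (k : fieldType) (C : coalgebra k) (A : algType k)
  (rho : {linear A -> A ⊗ C}) (e : C) (b : A) : Prop := rho b = b \ot e.

(* A right C-comodule and unital algebra A, whose coinvariants
   B = {b | ρ b = b ⊗ e} form a unital subalgebra such that ρ is left
   B-linear. *)
Record extension (k : fieldType) (C : coalgebra k) (e : C) := Extension {
  ext_sort :> algType k;
  coact : {linear ext_sort -> ext_sort ⊗ C};
  coactA : forall a,
    tassoc (tmap coact lid (coact a)) = tmap lid (comul C) (coact a);
  coact_counit : forall a, tscaler (tmap lid (counit C) (coact a)) = a;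
  coinv1 : coinvariant coact e 1;
  coinvM : forall b b', coinvariant coact e b -> coinvariant coact e b' ->
    coinvariant coact e (b * b');
  coactBl : forall b a, coinvariant coact e b ->
    coact (b * a) = tmap (lmul b) lid (coact a)
}.

Definition coinv (k : fieldType) (C : coalgebra k) (e : C) (A : extension e) :
  A -> Prop := coinvariant (coact A) e.

Section Galois.
Variables (k : fieldType) (C : coalgebra k) (e : C) (A : extension e).

(* A ⊗_B A *)
Inductive balanced_rel : A ⊗ A -> Prop :=
| Balanced a b a' : coinv b -> balanced_rel ((a * b) \ot a' - a \ot (b * a')).

Definition tensB := quotmod balanced_rel.
HB.instance Definition _ := GRing.Lmodule.on tensB.

Definition piB : {linear A ⊗ A -> tensB} := qpi balanced_rel.

(* a ⊗ a' |-> a a'_(0) ⊗ a'_(1), on A ⊗ A *)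
Definition can_free : {linear A ⊗ A -> A ⊗ C} :=
  tmap (tmul A) lid ∘ tassocV ∘ tmap lid (coact A).

Lemma tmap_lmul a (x : A ⊗ C) :
  tmap (tmul A) lid (tassocV (a \ot x)) = tmap (lmul a) lid x.
Proof.
rewrite -[LHS]/((tmap (tmul A) lid ∘ tassocV ∘ tpurel _ a) x); move: x.
by apply: tens_ext => a' c; rewrite !lcompE tpurelE tassocVE !tmapE tmulE.
Qed.

Lemma tmap_lmulM a b (x : A ⊗ C) :
  tmap (lmul (a * b)) lid x = tmap (lmul a) lid (tmap (lmul b) lid x).
Proof.
rewrite -[RHS]/((tmap (lmul a) lid ∘ tmap (lmul b) lid) x); move: x.
by apply: tens_ext => a' c; rewrite lcompE !tmapE !lmulE mulrA.
Qed.

Lemma can_freeE a a' : can_free (a \ot a') = tmap (lmul a) lid (coact A a').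
Proof. by rewrite !lcompE tmapE tmap_lmul. Qed.

Lemma can_rel x : balanced_rel x -> can_free x = 0.
Proof.
case=> a b a' hb; apply/eqP; rewrite linearB subr_eq0 !can_freeE.
by rewrite coactBl // tmap_lmulM.
Qed.

Definition can : {linear tensB -> A ⊗ C} := qlift can_rel.

Lemma canE a a' : can (piB (a \ot a')) = tmap (lmul a) lid (coact A a').
Proof. by rewrite [LHS]qliftE can_freeE. Qed.

(* right multiplication of A on A ⊗_B A *)
Lemma rmulB_rel a x : balanced_rel x -> (piB ∘ tmap lid (rmul a)) x = 0.
Proof.
case=> a1 b a2 hb; apply/qpi_eq0; rewrite linearB !tmapE !rmulE -mulrA.
exact/span_gen/Balanced.
Qed.

Definition rmulB (a : A) : {linear tensB -> tensB} := qlift (@rmulB_rel a).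

Lemma rmulBE a x : rmulB a (piB x) = piB (tmap lid (rmul a) x).
Proof. exact: qliftE. Qed.

Hypothesis can_bij : bijective can.

(* translation map *)
Definition transl : {linear C -> tensB} := linv can_bij ∘ tpurel C (1 : A).

Lemma psi_linl (a : A) : linear (fun c => can (rmulB a (transl c))).
Proof. by move=> x u v; rewrite !linearP. Qed.

Lemma psi_linr (c : C) : linear (fun a => can (rmulB a (transl c))).
Proof.
move=> x a a'; rewrite -linearP; congr (can _).
have [t ->] := qpi_surj (transl c); rewrite -/piB !rmulBE -linearP.
congr (piB _); elim/tens_ind: t => [|y u v t IH].
  by rewrite !linear0 ?scaler0 addr0.
rewrite !linearP IH !tmapE !rmulE mulrDr -scalerAr tpure_linearr.
by rewrite !scalerDr !scalerA [y * x]mulrC addrACA.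
Qed.

(* canonical entwining *)
Definition psi : {linear C ⊗ A -> A ⊗ C} := tlift psi_linl psi_linr.

Lemma psiE c a : psi (c \ot a) = can (rmulB a (transl c)).
Proof. exact: tliftE. Qed.

Hypothesis psi_bij : bijective psi.

Definition lcoact : {linear A -> C ⊗ A} := linv psi_bij ∘ tpurer A e.

(* ℓ is normalised, left colinear, right colinear, and lifts the translation
   map. *)
Definition strong_connection (l : {linear C -> A ⊗ A}) : Prop :=
  [/\ l e = 1 \ot 1,
      forall c, tassoc (tmap lcoact lid (l c)) = tmap lid l (comul C c),
      forall c, tmap lid (coact A) (l c) = tassoc (tmap l lid (comul C c))
    & forall c, piB (l c) = transl c].

(* M = A □^C A *)
Definition cotens : lmodType k :=
  equalizer (tassoc ∘ tmap (coact A) lid) (tmap lid lcoact).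

Definition cotens_incl : {linear cotens -> A ⊗ A} := eqz_incl _ _.

Definition cotens_eps : {linear cotens -> A} := tmul A ∘ cotens_incl.

(* ρ(a a') = a_(0) ψ(a_(1) ⊗ a') *)
Fact mul_psi_key : unit. Proof. exact: tt. Qed.
Definition mul_psi : {linear A ⊗ (C ⊗ A) -> A ⊗ C} :=
  locked_with mul_psi_key (tmap (tmul A) lid ∘ tassocV ∘ tmap lid psi).

Lemma mul_psiE a y : mul_psi (a \ot y) = tmap (lmul a) lid (psi y).
Proof. by rewrite /mul_psi unlock !lcompE tmapE tmap_lmul. Qed.

Lemma can_lmul a (x : A ⊗ A) :
  can (piB (tmap (lmul a) lid x)) = tmap (lmul a) lid (can (piB x)).
Proof.
rewrite -[LHS]/((can ∘ piB ∘ tmap (lmul a) lid) x).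
rewrite -[RHS]/((tmap (lmul a) lid ∘ can ∘ piB) x); move: x.
by apply: tens_ext => u v; rewrite !lcompE tmapE !canE lmulE tmap_lmulM.
Qed.

Lemma lmul_rmul a b (x : A ⊗ A) :
  tmap lid (rmul b) (tmap (lmul a) lid x) =
  tmap (lmul a) lid (tmap lid (rmul b) x).
Proof.
rewrite -[LHS]/((tmap lid (rmul b) ∘ tmap (lmul a) lid) x).
rewrite -[RHS]/((tmap (lmul a) lid ∘ tmap lid (rmul b)) x); move: x.
by apply: tens_ext => u v; rewrite !lcompE !tmapE.
Qed.

Lemma can_translK c : can (transl c) = 1 \ot c.
Proof. exact: linvK. Qed.

Lemma can_rmulB a' (x : A ⊗ C) :
  can (rmulB a' (linv can_bij x)) = mul_psi (tassoc (x \ot a')).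
Proof.
rewrite -[LHS]/((can ∘ rmulB a' ∘ linv can_bij) x).
rewrite -[RHS]/((mul_psi ∘ tassoc ∘ tpurer _ a') x); move: x.
apply: tens_ext => a c; rewrite !lcompE tpurerE tassocE mul_psiE psiE.
have [t ht] := qpi_surj (transl c).
have -> : linv can_bij (a \ot c) = piB (tmap (lmul a) lid t).
  apply: (bij_inj can_bij); rewrite linvK can_lmul -[piB t]ht can_translK.
  by rewrite tmapE lmulE mulr1.
by rewrite ht -/piB !rmulBE lmul_rmul can_lmul.
Qed.

Lemma tmap_lmul1 (x : A ⊗ C) : tmap (lmul 1) lid x = x.
Proof.
rewrite -[RHS]/(lid x); move: x.
by apply: tens_ext => a c; rewrite tmapE lmulE mul1r.
Qed.

Lemma coact_mul a a' :
  coact A (a * a') = mul_psi (tassoc (coact A a \ot a')).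
Proof.
rewrite -can_rmulB; have -> : coact A a = can (piB (1 \ot a)).
  by rewrite canE tmap_lmul1.
by rewrite linvKV rmulBE tmapE rmulE canE tmap_lmul1.
Qed.

Lemma cotens_eps_coinv (x : cotens) : coinv (cotens_eps x).
Proof.
rewrite /coinv /coinvariant /cotens_eps lcompE.
have hx : tassoc (tmap (coact A) lid (cotens_incl x)) =
  tmap lid lcoact (cotens_incl x) := equalizerP x.
have -> (y : A ⊗ A) : coact A (tmul A y) =
    mul_psi (tassoc (tmap (coact A) lid y)).
  rewrite -[LHS]/((coact A ∘ tmul A) y).
  rewrite -[RHS]/((mul_psi ∘ tassoc ∘ tmap (coact A) lid) y); move: y.
  by apply: tens_ext => a a'; rewrite !lcompE tmulE tmapE coact_mul.
rewrite hx; move: (cotens_incl x) => y.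
rewrite -[LHS]/((mul_psi ∘ tmap lid lcoact) y).
rewrite -[RHS]/((tpurer A e ∘ tmul A) y); move: y.
apply: tens_ext => a a'; rewrite !lcompE tmapE mul_psiE tmulE tpurerE.
by rewrite [psi _](linvK psi_bij) tpurerE tmapE lmulE.
Qed.

Lemma cotens_lmul (b : A) (x : cotens) : coinv b ->
  (tassoc ∘ tmap (coact A) lid) (tmap (lmul b) lid (cotens_incl x)) =
  tmap lid lcoact (tmap (lmul b) lid (cotens_incl x)).
Proof.
move=> hb.
have hx : tassoc (tmap (coact A) lid (cotens_incl x)) =
  tmap lid lcoact (cotens_incl x) := equalizerP x.
transitivity (tmap (lmul b) lid (tmap lid lcoact (cotens_incl x))); last first.
  move: (cotens_incl x) => y.
  rewrite -[LHS]/((tmap (lmul b) lid ∘ tmap lid lcoact) y).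
  rewrite -[RHS]/((tmap lid lcoact ∘ tmap (lmul b) lid) y); move: y.
  by apply: tens_ext => u v; rewrite !lcompE !tmapE.
rewrite -hx; move: (cotens_incl x) => y.
rewrite -[RHS]/((tmap (lmul b) lid ∘ tassoc ∘ tmap (coact A) lid) y).
rewrite -[LHS]/((tassoc ∘ tmap (coact A) lid ∘ tmap (lmul b) lid) y); move: y.
apply: tens_ext => u v; rewrite !lcompE !tmapE lmulE coactBl //.
transitivity (tassoc (tmap (tmap (lmul b) lid) (@lid k A) (coact A u \ot v))).
  by rewrite tmapE.
rewrite tmap_assoc.
have E : tmap (@lid k C) (@lid k A) =1 lid.
  by apply: tens_ext => c a; rewrite tmapE.
move: (tassoc _) => z; rewrite -[LHS]/(tmap _ _ z) -[RHS]/(tmap _ _ z).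
by move: z; apply: tens_ext => c y; rewrite !tmapE E.
Qed.

(* x · y = ε(x) y *)
Definition cotens_mul_fun (x y : cotens) : cotens :=
  eqz_mk (cotens_lmul y (cotens_eps_coinv x)).

Lemma cotens_mul_incl x y :
  cotens_incl (cotens_mul_fun x y) =
  tmap (lmul (cotens_eps x)) lid (cotens_incl y).
Proof. by []. Qed.

Lemma cotens_mul_linl y : linear (cotens_mul_fun^~ y).
Proof.
move=> a x x'; apply: val_inj; rewrite -[LHS]/(cotens_incl _).
rewrite -[RHS]/(cotens_incl _) linearP !cotens_mul_incl.
move: (cotens_incl y) => z; rewrite linearP.
elim/tens_ind: z => [|c u v z IH]; first by rewrite !linear0 ?scaler0 addr0.
rewrite !linearP IH !tmapE !lmulE mulrDl -scalerAl tpure_linearl.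
by rewrite !scalerDr !scalerA [c * a]mulrC addrACA.
Qed.

Lemma cotens_mul_linr x : linear (cotens_mul_fun x).
Proof.
move=> a y y'; apply: val_inj; rewrite -[LHS]/(cotens_incl _).
by rewrite -[RHS]/(cotens_incl _) linearP !cotens_mul_incl !linearP.
Qed.

Definition cotens_mul : {linear (cotens ⊗ cotens)%type -> cotens} :=
  tlift cotens_mul_linl cotens_mul_linr.

Lemma cotens_mulE x y : cotens_mul (x \ot y) = cotens_mul_fun x y.
Proof. exact: tliftE. Qed.

Lemma cotens_eps_mul x y :
  cotens_eps (cotens_mul_fun x y) = cotens_eps x * cotens_eps y.
Proof.
rewrite [LHS]lcompE cotens_mul_incl [cotens_eps y]lcompE.
move: (cotens_incl y) => z.
rewrite -[LHS]/((tmul A ∘ tmap (lmul (cotens_eps x)) lid) z).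
rewrite -[RHS]/((lmul (cotens_eps x) ∘ tmul A) z); move: z.
by apply: tens_ext => a a'; rewrite !lcompE tmapE !tmulE !lmulE mulrA.
Qed.

Lemma cotens_mulA x y z :
  cotens_mul (cotens_mul (x \ot y) \ot z) =
  cotens_mul (x \ot cotens_mul (y \ot z)).
Proof.
rewrite !cotens_mulE; apply: val_inj; rewrite -[LHS]/(cotens_incl _).
rewrite -[RHS]/(cotens_incl _) !cotens_mul_incl cotens_eps_mul.
move: (cotens_incl z) => w.
rewrite -[RHS]/((tmap (lmul (cotens_eps x)) lid ∘
  tmap (lmul (cotens_eps y)) lid) w); move: w.
by apply: tens_ext => a c; rewrite lcompE !tmapE !lmulE mulrA.
Qed.

End Galois.

(* Iterated tensor powers: tpow V n is V^{⊗(n+1)}, bracketed to the right. *)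
Section TensorPower.
Variable k : fieldType.
Implicit Types V W : lmodType k.

Fixpoint tpow V (n : nat) : lmodType k :=
  if n is n'.+1 then V ⊗ tpow V n' else V.

(* v 0 ⊗ ... ⊗ v n *)
Fixpoint tpows V (v : nat -> V) (n : nat) : tpow V n :=
  if n is n'.+1 then v 0 \ot tpows (fun i => v i.+1) n' else v 0.

Fixpoint tpow_map V W (f : {linear V -> W}) n : {linear tpow V n -> tpow W n} :=
  if n is n'.+1 then tmap f (tpow_map f n') else f.

Lemma tpow_mapE V W (f : {linear V -> W}) v n :
  tpow_map f n (tpows v n) = tpows (fun i => f (v i)) n.
Proof. by elim: n v => [|n IH] v //; rewrite tmapE IH. Qed.

(* v 0 ⊗ ... ⊗ v n |-> v n ⊗ v 0 ⊗ ... ⊗ v (n-1) *)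
Fixpoint trot V n : {linear tpow V n -> tpow V n} :=
  match n with
  | 0 => lid
  | n'.+1 =>
    match n' return {linear tpow V n' -> tpow V n'} ->
                    {linear tpow V n'.+1 -> tpow V n'.+1} with
    | 0 => fun _ => tswap
    | n''.+1 => fun rot => tassoc ∘ tmap tswap lid ∘ tassocV ∘ tmap lid rot
    end (trot V n')
  end.

Lemma tpows_ext V (v w : nat -> V) n :
  (forall i, (i <= n)%N -> v i = w i) -> tpows v n = tpows w n.
Proof.
elim: n v w => [|n IH] v w h /=; first exact: h.
by rewrite h //; congr (_ \ot _); apply: IH => i hi; apply: h.
Qed.

Lemma trotE V (v : nat -> V) n :
  trot V n (tpows v n) = tpows (fun i => if i is j.+1 then v j else v n) n.
Proof.
case: n => [|n] //; elim: n v => [|n IH] v; first exact: tswapE.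
transitivity (tassoc (tmap tswap lid (tassocV (tmap lid (trot V n.+1)
    (v 0 \ot tpows (fun i => v i.+1) n.+1))))); first by [].
by rewrite tmapE (IH (fun i => v i.+1)) tassocVE tmapE tswapE tassocE.
Qed.

End TensorPower.

Record nualg (k : fieldType) := NUAlg {
  na_sort :> lmodType k;
  na_mul : {linear na_sort ⊗ na_sort -> na_sort};
  na_mulA : forall x y z,
    na_mul (na_mul (x \ot y) \ot z) = na_mul (x \ot na_mul (y \ot z))
}.

Section Cyclic.
Variables (k : fieldType) (R : nualg k).
Notation T := (tpow R).

(* r^0 ⊗ ... ⊗ r^(n+1) |-> r^0 ⊗ ... ⊗ r^i r^(i+1) ⊗ ... ⊗ r^(n+1), for i <= n;
   the value for i > n is irrelevant. *)
Fixpoint face (i n : nat) : {linear T n.+1 -> T n} :=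
  match i, n with
  | 0, 0 => na_mul R
  | 0, n'.+1 => tmap (na_mul R) lid ∘ tassocV
  | i'.+1, 0 => [the {linear _ -> _} of \0]
  | i'.+1, n'.+1 => tmap lid (face i' n')
  end.

Lemma faceE i n (r : nat -> R) : (i <= n)%N ->
  face i n (tpows r n.+1) =
  tpows (fun j => if (j < i)%N then r j
                  else if j == i then na_mul R (r i \ot r i.+1)
                  else r j.+1) n.
Proof.
elim: i n r => [|i IH] [|n] r // hi; first by rewrite /= tassocVE tmapE lidE.
transitivity (tmap lid (face i n) (r 0 \ot tpows (fun j => r j.+1) n.+1)).
  by [].
by rewrite tmapE IH.
Qed.

Definition hoch_bp_fun n (x : T n.+1) : T n :=
  \sum_(i < n.+1) (-1) ^+ i *: face i n x.
Definition hoch_b_fun n (x : T n.+1) : T n :=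
  hoch_bp_fun x + (-1) ^+ n.+1 *: face 0 n (trot R n.+1 x).
Definition cyc_t_fun n (x : T n) : T n := (-1) ^+ n *: trot R n x.
Definition cyc_N_fun n (x : T n) : T n := \sum_(i < n.+1) iter i (@cyc_t_fun n) x.

Lemma hoch_bp_linear n : linear (@hoch_bp_fun n).
Proof.
move=> a x y; rewrite /hoch_bp_fun scaler_sumr -big_split; apply: eq_bigr => i _ /=.
by rewrite linearP scalerDr !scalerA mulrC.
Qed.
Lemma hoch_b_linear n : linear (@hoch_b_fun n).
Proof.
move=> a x y; rewrite /hoch_b_fun hoch_bp_linear !linearP.
by rewrite !scalerDr !scalerA [a * _]mulrC addrACA.
Qed.
Lemma cyc_t_linear n : linear (@cyc_t_fun n).
Proof. by move=> a x y; rewrite /cyc_t_fun linearP scalerDr !scalerA mulrC. Qed.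
Lemma cyc_N_linear n : linear (@cyc_N_fun n).
Proof.
move=> a x y; rewrite /cyc_N_fun scaler_sumr -big_split; apply: eq_bigr => i _ /=.
by elim: (i : nat) => //= j ->; rewrite cyc_t_linear.
Qed.

Definition hoch_bp n : {linear T n.+1 -> T n} := mklin (@hoch_bp_linear n).
Definition hoch_b n : {linear T n.+1 -> T n} := mklin (@hoch_b_linear n).
Definition cyc_t n : {linear T n -> T n} := mklin (@cyc_t_linear n).
Definition cyc_N n : {linear T n -> T n} := mklin (@cyc_N_linear n).

(* vertical differential of CC(R) in column p, from row q + 1 to row q *)
Definition vert p q : {linear T q.+1 -> T q} :=
  if odd p then [the {linear _ -> _} of \- (hoch_bp q)] else hoch_b q.

(* horizontal differential of CC(R) in row q, from column p to column p - 1 *)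
Definition horiz p q : {linear T q -> T q} :=
  if odd p then [the {linear _ -> _} of lid \- cyc_t q] else cyc_N q.

(* Tot CC_n(R): the component m, in T m, is in row m and column n - m. *)
Definition tot n := {dffun forall m : 'I_n.+1, T m}.
HB.instance Definition _ n := Choice.on (tot n).

Definition tot0 n : tot n := [ffun m : 'I_n.+1 => 0 : T m].
Definition totN n (x : tot n) : tot n := [ffun m : 'I_n.+1 => - x m : T m].
Definition totD n (x y : tot n) : tot n :=
  [ffun m : 'I_n.+1 => x m + y m : T m].
Definition totZ n (a : k) (x : tot n) : tot n :=
  [ffun m : 'I_n.+1 => a *: x m : T m].

Lemma totDA n : associative (@totD n).
Proof. by move=> x y z; apply/ffunP => m; rewrite !ffunE addrA. Qed.
Lemma totDC n : commutative (@totD n).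
Proof. by move=> x y; apply/ffunP => m; rewrite !ffunE addrC. Qed.
Lemma totD0 n : left_id (tot0 n) (@totD n).
Proof. by move=> x; apply/ffunP => m; rewrite !ffunE add0r. Qed.
Lemma totDN n : left_inverse (tot0 n) (@totN n) (@totD n).
Proof. by move=> x; apply/ffunP => m; rewrite !ffunE addNr. Qed.
HB.instance Definition _ n :=
  GRing.isZmodule.Build (tot n) (@totDA n) (@totDC n) (@totD0 n) (@totDN n).

Lemma totZA n a a' (x : tot n) : totZ a (totZ a' x) = totZ (a * a') x.
Proof. by apply/ffunP => m; rewrite !ffunE scalerA. Qed.
Lemma totZ1 n : left_id 1 (@totZ n).
Proof. by move=> x; apply/ffunP => m; rewrite !ffunE scale1r. Qed.
Lemma totZDr n : right_distributive (@totZ n) +%R.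
Proof. by move=> a x y; apply/ffunP => m; rewrite !ffunE scalerDr. Qed.
Lemma totZDl n (x : tot n) : {morph (@totZ n)^~ x : a a' / a + a'}.
Proof. by move=> a c; apply/ffunP => m; rewrite !ffunE scalerDl. Qed.
HB.instance Definition _ n := GRing.Zmodule_isLmodule.Build k (tot n)
  (@totZA n) (@totZ1 n) (@totZDr n) (@totZDl n).

Lemma tot_addE n (x y : tot n) m : (x + y) m = x m + y m.
Proof. exact: ffunE. Qed.
Lemma tot_scaleE n a (x : tot n) m : (a *: x) m = a *: x m.
Proof. exact: ffunE. Qed.

Definition row_up n (m : 'I_n.+1) : 'I_n.+2 :=
  @Ordinal n.+2 m.+1 (ltn_ord m).
Definition row_wd n (m : 'I_n.+1) : 'I_n.+2 :=
  @Ordinal n.+2 m (leqW (ltn_ord m)).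

(* the component of row m + 1, column n - m and the one of row m, column
   n + 1 - m, are sent to row m, column n - m *)
Definition tot_dS_fun n (x : tot n.+1) : tot n :=
  [ffun m : 'I_n.+1 => vert (n - m) m (x (row_up m)) +
                       horiz (n - m).+1 m (x (row_wd m)) : T m].

Lemma tot_dS_linear n : linear (@tot_dS_fun n).
Proof.
move=> a x y; apply/ffunP => m.
rewrite !(ffunE, tot_addE, tot_scaleE) !linearP.
by rewrite scalerDr addrACA.
Qed.

Definition tot_d n : {linear tot n -> tot n.-1} :=
  match n return {linear tot n -> tot n.-1} with
  | 0 => [the {linear _ -> _} of \0]
  | n'.+1 => mklin (@tot_dS_linear n')
  end.

Definition cycles n : lmodType k :=
  equalizer (tot_d n) [the {linear _ -> _} of \0].

Definition cycle_mk n (x : tot n) (hx : tot_d n x = 0) : cycles n :=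
  @eqz_mk k _ _ (tot_d n) [the {linear _ -> _} of \0] x hx.

Definition boundary n (z : cycles n) : Prop :=
  exists y : tot n.+1, val z = tot_d n.+1 y.

Definition HC n : lmodType k := quotmod (@boundary n).

Definition HC_class n (x : tot n) (hx : tot_d n x = 0) : HC n :=
  qpi (@boundary n) (cycle_mk hx).

(* projection onto the columns p >= 2, shifted *)
Definition row_wd2 n (m : 'I_n.+1) : 'I_n.+3 :=
  @Ordinal n.+3 m (leqW (leqW (ltn_ord m))).

Definition Stot_fun n (x : tot n.+2) : tot n :=
  [ffun m : 'I_n.+1 => x (row_wd2 m) : T m].

Lemma Stot_linear n : linear (@Stot_fun n).
Proof.
by move=> a x y; apply/ffunP => m; rewrite !(ffunE, tot_addE, tot_scaleE).
Qed.

Definition Stot n : {linear tot n.+2 -> tot n} := mklin (@Stot_linear n).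

Lemma tot_irr n (x : tot n) m (h1 h2 : (m < n.+1)%N) :
  x (Ordinal h1) = x (Ordinal h2) :> T m.
Proof. by rewrite (bool_irrelevance h1 h2). Qed.

Lemma Stot_tot_d n (x : tot n.+3) : Stot n (tot_d n.+3 x) = tot_d n.+1 (Stot n.+1 x).
Proof.
apply/ffunP => m.
transitivity (vert (n.+2 - m) m (x (row_up (row_wd2 m))) +
  horiz (n.+2 - m).+1 m (x (row_wd (row_wd2 m))) : T m).
  by rewrite [LHS]ffunE [LHS]ffunE.
transitivity (vert (n - m) m (x (row_wd2 (row_up m))) +
  horiz (n - m).+1 m (x (row_wd2 (row_wd m))) : T m); last first.
  by rewrite [RHS]ffunE !ffunE.
have hm : (m <= n)%N by rewrite -ltnS ltn_ord.
have E : (n.+2 - m = (n - m).+2)%N by rewrite -addn2 -addnBAC // addn2.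
rewrite E /vert /horiz /= negbK.
have E1 : x (row_up (row_wd2 m)) = x (row_wd2 (row_up m)) :> T m.+1 := tot_irr x _ _.
have E2 : x (row_wd (row_wd2 m)) = x (row_wd2 (row_wd m)) :> T m := tot_irr x _ _.
by congr (_ + _); case: ifP => _; rewrite ?E1 ?E2.
Qed.

Lemma Stot_cycle n (z : cycles n.+2) : tot_d n (Stot n (val z)) = 0.
Proof.
have hz : tot_d n.+2 (val z) = 0 := equalizerP z.
by case: n z hz => [|n] z hz //; rewrite -Stot_tot_d hz linear0.
Qed.

Definition Scyc_fun n (z : cycles n.+2) : cycles n := cycle_mk (Stot_cycle z).

Lemma Scyc_linear n : linear (@Scyc_fun n).
Proof. by move=> a x y; apply: val_inj; rewrite linearP /= !linearP. Qed.

Definition Scyc n : {linear cycles n.+2 -> cycles n} := mklin (@Scyc_linear n).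

Lemma Scyc_boundary n z : @boundary n.+2 z -> (qpi (@boundary n) ∘ Scyc n) z = 0.
Proof.
case=> y hy; apply/qpi_eq0/span_gen; exists (Stot n.+1 y).
by rewrite -Stot_tot_d -hy.
Qed.

(* Connes' periodicity operator *)
Definition HC_S n : {linear HC n.+2 -> HC n} := qlift (@Scyc_boundary n).

Lemma HC_SE n (x : tot n.+2) hx (hSx : tot_d n (Stot n x) = 0) :
  HC_S n (@HC_class n.+2 x hx) = HC_class hSx.
Proof. by rewrite [LHS]qliftE; congr (qpi _ _); apply: val_inj. Qed.

End Cyclic.
Arguments tot_d {k R} n.
Arguments HC_S {k R n}.

Section ChernWeil.
Variables (k : fieldType) (C : coalgebra k) (e : C) (A : extension e).
Hypotheses (can_bij : bijective (can A)) (psi_bij : bijective (psi can_bij)).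

(* M with x · y = ε(x) y *)
Definition cotens_alg : nualg k := NUAlg (@cotens_mulA k C e A can_bij psi_bij).

End ChernWeil.

Section Chern.
Variable k : fieldType.

(* c |-> c_(1) ⊗ ... ⊗ c_(n+1) *)
Fixpoint icomul (C : coalgebra k) n : {linear C -> tpow C n} :=
  if n is n'.+1 then tmap lid (icomul C n') ∘ comul C else lid.

Section Relink.
Variable V : lmodType k.

(* (v 0 ⊗ w 0) ⊗ ... ⊗ (v n ⊗ w n) |-> v 0 ⊗ w 0 ⊗ ... ⊗ v n ⊗ w n *)
Fixpoint flat n : {linear tpow (V ⊗ V) n -> tpow V n.*2.+1} :=
  if n is n'.+1 then tassoc ∘ tmap lid (flat n') else lid.

Fixpoint pairup n : {linear tpow V n.*2.+1 -> tpow (V ⊗ V) n} :=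
  if n is n'.+1 then tmap lid (pairup n') ∘ tassocV else lid.

Definition relink n : {linear tpow (V ⊗ V) n -> tpow (V ⊗ V) n} :=
  pairup n ∘ trot V n.*2.+1 ∘ flat n.

Lemma flatE (v w : nat -> V) n :
  flat n (tpows (fun i => v i \ot w i) n) =
  tpows (fun i => if odd i then w i./2 else v i./2) n.*2.+1.
Proof.
elim: n v w => [|n IH] v w //.
transitivity (tassoc (tmap lid (flat n)
  ((v 0 \ot w 0) \ot tpows (fun i => v i.+1 \ot w i.+1) n))); first by [].
rewrite tmapE IH tassocE.
transitivity (v 0 \ot (w 0 \ot tpows (fun i =>
    if odd i.+2 then w (i.+2)./2 else v (i.+2)./2) n.*2.+1)); last by [].
congr (_ \ot (_ \ot _)).
by apply: (@tpows_ext _ _ _ _ n.*2.+1) => i _ /=; rewrite negbK.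
Qed.

Lemma pairupE (v : nat -> V) n :
  pairup n (tpows v n.*2.+1) = tpows (fun i => v i.*2 \ot v i.*2.+1) n.
Proof.
elim: n v => [|n IH] v //.
transitivity (tmap lid (pairup n) (tassocV
  (v 0 \ot (v 1 \ot tpows (fun i => v i.+2) n.*2.+1)))); first by [].
by rewrite tassocVE tmapE IH.
Qed.

Lemma relinkE (v w : nat -> V) n :
  relink n (tpows (fun i => v i \ot w i) n) =
  tpows (fun i => if i is j.+1 then w j \ot v i else w n \ot v 0) n.
Proof.
rewrite [LHS]lcompE lcompE flatE trotE pairupE.
apply: tpows_ext => -[|i] _ /=; first by rewrite odd_double uphalf_double.
by rewrite /= !odd_double /= ?doubleK ?uphalf_double.
Qed.

End Relink.

(* c_m(ℓ)(c), as an element of (A ⊗ A)^{⊗(m+1)}: the tensor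
   ℓ(c_(1)) ⊗ ... ⊗ ℓ(c_(m+1)), regrouped. *)
Definition chern (C : coalgebra k) (A : lmodType k) (l : {linear C -> A ⊗ A})
  (m : nat) (c : C) : tpow (A ⊗ A) m :=
  relink A m (tpow_map l m (icomul C m c)).

(* The quotient m! / ⌊m/2⌋! is an exact division in nat. *)
Definition chw (R : nualg k) (x : forall m, tpow R m) (n : nat) :
  tot R n.*2 :=
  [ffun m : 'I_n.*2.+1 =>
    (-1) ^+ m./2 * (m`! %/ (m./2)`!)%:R *: x m : tpow R m].

End Chern.

(* Main.v *)
Require Import Defs.
From mathcomp Require Import all_boot ssralg.
From mathcomp Require boolp classical_sets.
Set Implicit Arguments.
Unset Strict Implicit.
Unset Printing Implicit Defensive.
Import GRing.Theory.
Local Open Scope ring_scope.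

(* The elements c_m(ℓ)(c) are invariant under cyclic rotation because c is in
   C^tr, and the head factor c_(m+1)^<2> ⊗ c_(1)^<1> satisfies the cotensor
   condition: by bicolinearity of ℓ its two sides insert into it the first, resp.
   the last, leg of an iterated coproduct of c. Since k is a field, A □^C A is
   the image of a projection P of A ⊗ A, and by rotation invariance every factor
   is fixed by P; so c_m(ℓ)(c) lifts uniquely to M^{⊗(m+1)}.
   As c^<1> c^<2> = ε(c), multiplying two neighbouring factors maps c_(m+1) to
   c_m, so every face does so. Hence b' c_(m+1) is c_m or 0 and b c_(m+1) is 0 or
   c_m according to the parity of m, while N c_m = (m + 1) c_m or 0 and
   (1 - t) c_m = 0 or 2 c_m. The coefficients of chw make the total differential
   telescope, and S merely deletes the top two components. *)

(** * Generalized inverses of linear maps *)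

Section GeneralizedInverse.
Variables (k : fieldType) (V W : lmodType k) (h : {linear V -> W}).

(* Graphs of linear maps s, defined on a subspace of W, with h (s (h x)) = h x. *)
Definition partial_ginv (G : W * V -> Prop) : Prop :=
  [/\ forall a p q, G p -> G q -> G (a *: p + q),
      forall v, G (0, v) -> v = 0
    & forall x v, G (h x, v) -> h v = h x].

(** The extension step for Zorn's lemma. The value at a new point [w] is constrained only if a
    translate of [w] by the domain of [G] meets the range of [h]. *)
Lemma partial_ginv_extend (G : W * V -> Prop) (w : W) :
    partial_ginv G -> G 0 -> ~ (exists v, G (w, v)) ->
  exists v, partial_ginv (fun p => exists a q, G q /\ p = a *: (w, v) + q).
Proof.
move=> [Glin Gfun Gh] G0 wG.
have GZ a q : G q -> G (a *: q) by move=> Gq; rewrite -[_ *: q]addr0; apply: Glin.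
have [v hv] : exists v, forall a q x, G q ->
    a *: w + q.1 = h x -> h (a *: v + q.2) = h x.
  have [[q0 [x0 [Gq0 E0]]]|nE] :=
    boolp.EM (exists q0 x0, G q0 /\ w + q0.1 = h x0).
  (* A preimage [x0] of [w + q0.1] fixes the value up to the kernel of [h]; other multiples of [w]
     reduce to this one by linearity. *)
  - exists (x0 - q0.2) => a q x Gq E.
    have := Glin (- a) _ _ Gq0 Gq.
    rewrite [_ + _]surjective_pairing /=.
    have -> : - a *: q0.1 + q.1 = h (x - a *: x0).
      rewrite linearB linearZ /= -E -E0 scalerDr scaleNr opprD.
      by rewrite [a *: w + _]addrC addrA addrK addrC.
    move=> /Gh /(congr1 (+%R^~ (h (a *: x0)))); rewrite -!linearD subrK => <-.
    by congr (h _); rewrite scalerBr scaleNr -addrA addrC.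
  (* Here only [a = 0] can occur, after rescaling, so any value would do. *)
  - exists 0 => a q x Gq; have [->|a0] := eqVneq a 0.
      rewrite !scale0r !add0r => E.
      by apply: Gh; rewrite -E -surjective_pairing.
    move=> E; case: nE; exists (a^-1 *: q), (a^-1 *: x); split; first exact: GZ.
    by rewrite [h _]linearZ /= -E scalerDr scalerA mulVf ?scale1r.
exists v; split=> [b p q [a [p' [Gp' ->]]] [a' [q' [Gq' ->]]]
                   |v' [a [q [Gq E]]]|x v' [a [q [Gq E]]]].
- exists (b * a + a'), (b *: p' + q'); split; first exact: Glin.
  by rewrite scalerDr scalerA scalerDl addrACA.
(* A nonzero [a] would put [w] itself into the domain of [G]. *)
- case: E => Ew ->; have [a0|a0] := eqVneq a 0; last first.
    case: wG; exists (- a^-1 *: q.2); have := GZ (- a^-1) _ Gq.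
    rewrite [_ *: q]surjective_pairing /=; congr (G (_, _)).
    move/(congr1 ( *:%R a^-1)): Ew.
    rewrite scaler0 scalerDr scalerA mulVf // scale1r => /eqP.
    by rewrite eq_sym addr_eq0 => /eqP ->; rewrite scaleNr.
  move: Ew; rewrite a0 !scale0r !add0r => Ew.
  by apply: Gfun; rewrite Ew -surjective_pairing.
- by case: E => Ew ->; apply: hv.
Qed.

(** Zorn's lemma for inclusion of graphs: a maximal graph that misses a point could be extended
    there. *)
Lemma exists_total_partial_ginv :
  exists2 G, partial_ginv G & forall w, exists v, G (w, v).
Proof.
have bigcup_ginv (F : (W * V -> Prop) -> Prop) :
    (forall G, F G -> partial_ginv G) ->
    (forall G G', F G -> F G' -> (forall p, G p -> G' p) \/ (forall p, G' p -> G p)) ->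
    partial_ginv (fun p => exists2 G, F G & G p).
  move=> FP Ftot; split=> [a p q [G FG Gp] [G' FG' G'q]|v [G FG]|x v [G FG]].
  - have [GG'|G'G] := Ftot _ _ FG FG'.
      by exists G' => //; have [] := FP _ FG' => + _ _; apply => //; apply: GG'.
    by exists G => //; have [] := FP _ FG => + _ _; apply => //; apply: G'G.
  - by have [_ + _] := FP _ FG; apply.
  - by have [_ _] := FP _ FG; apply.
have [G [PG Gmax]] := classical_sets.Zorn_bigcup bigcup_ginv.
have G_top G' : partial_ginv G' -> (forall p, G p -> G' p) ->
    forall p, G' p -> G p.
  move=> PG' GG' p G'p; apply: boolp.contrapT => nGp.
  by apply: (Gmax G') PG'; split => // G'G; apply/nGp/G'G.
(* The empty graph is also a [partial_ginv], so that 0 belongs to [G] has to come from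
   maximality. *)
have G0 : G 0.
  apply: (G_top (fun p => G p \/ p = 0)); [|by left|by right].
  have [Glin Gfun Gh] := PG; split=> [a p q|v|x v].
  - case=> [Gp|->] [Gq|->]; rewrite ?scaler0 ?addr0 ?add0r.
    + by left; apply: Glin.
    + left; have /(Glin (a - 1) _ _ Gp) := Gp.
      by rewrite -[X in _ + X]scale1r -scalerDl subrK.
    + by left.
    + by right.
  - by case=> [/Gfun|[]].
  - by case=> [/Gh|[-> ->]] //; rewrite linear0.
exists G => // w; apply: boolp.contrapT => wG.
have [v Pv] := partial_ginv_extend PG G0 wG.
apply: wG; exists v; apply: (G_top _ Pv).
  by move=> p Gp; exists 0, p; rewrite scale0r add0r.
by exists 1, 0; rewrite scale1r addr0.
Qed.

Lemma lin_ginv : exists s : {linear W -> V}, forall x, h (s (h x)) = h x.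
Proof.
have [G [Glin Gfun Gh] Gtot] := exists_total_partial_ginv.
have [f fG] := boolp.choice Gtot.
have Guniq w v v' : G (w, v) -> G (w, v') -> v = v'.
  move=> Gv /(Glin (-1) _ _ Gv); rewrite scaleN1r.
  rewrite -[- _ + _]/(- w + w, - v + v') addNr addrC => /Gfun/eqP.
  by rewrite subr_eq0 => /eqP.
have f_lin : linear f.
  by move=> a u u'; apply: (Guniq (a *: u + u')) => //; apply: (Glin a (u, _) (u', _)).
by exists (mklin f_lin) => x; apply: Gh (fG _).
Qed.

End GeneralizedInverse.

(** * Tensor powers and cyclic rotations *)

Section TensorPowers.
Variable k : fieldType.
Implicit Types U V W : lmodType k.

Lemma tpow_ext V U n (f g : {linear tpow V n -> U}) :
  (forall v, f (tpows v n) = g (tpows v n)) -> f =1 g.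
Proof.
elim: n f g => [|n IH] f g fg; first by move=> x; apply: (fg (fun=> x)).
apply: tens_ext => v y; apply: (IH (f ∘ tpurel _ v) (g ∘ tpurel _ v)) => w.
exact: (fg (fun i => if i is j.+1 then w j else v)).
Qed.

Lemma tpow_tens_ext V W U n (f g : {linear tpow (V ⊗ W)%type n -> U}) :
  (forall v w, f (tpows (fun i => v i \ot w i) n) =
               g (tpows (fun i => v i \ot w i) n)) -> f =1 g.
Proof.
elim: n f g => [|n IH] f g fg.
  by apply: tens_ext => v w; apply: (fg (fun=> v) (fun=> w)).
apply: tens_ext => x y.
apply: (@tens_ext _ _ _ _ (f ∘ tpurer _ y) (g ∘ tpurer _ y)) => v w.
apply: (IH (f ∘ tpurel _ (v \ot w)) (g ∘ tpurel _ (v \ot w))) => v' w'.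
exact: (fg (fun i => if i is j.+1 then v' j else v)
           (fun i => if i is j.+1 then w' j else w)).
Qed.

Lemma tmap_comp U V W U' V' W' (g : {linear V -> W}) (f : {linear U -> V})
    (g' : {linear V' -> W'}) (f' : {linear U' -> V'}) x :
  tmap g g' (tmap f f' x) = tmap (g ∘ f) (g' ∘ f') x.
Proof.
rewrite -[LHS]/((tmap g g' ∘ tmap f f') x); move: x.
by apply: tens_ext => u u'; rewrite lcompE !tmapE.
Qed.

Lemma eq_tmap V V' W W' (f f' : {linear V -> V'}) (g g' : {linear W -> W'}) :
  f =1 f' -> g =1 g' -> tmap f g =1 tmap f' g'.
Proof. by move=> ff' gg'; apply: tens_ext => v w; rewrite !tmapE ff' gg'. Qed.

Lemma tmap_swap V V' W W' (f : {linear V -> V'}) (g : {linear W -> W'}) x :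
  tswap (tmap f g x) = tmap g f (tswap x).
Proof.
rewrite -[LHS]/((tswap ∘ tmap f g) x) -[RHS]/((tmap g f ∘ tswap) x); move: x.
by apply: tens_ext => v w; rewrite !lcompE !(tmapE, tswapE).
Qed.

Lemma tpow_map_comp U V W (g : {linear V -> W}) (f : {linear U -> V}) n x :
  tpow_map g n (tpow_map f n x) = tpow_map (g ∘ f) n x.
Proof. by elim: n x => [|n IH] x //=; rewrite tmap_comp; apply: eq_tmap. Qed.

Lemma tpow_map_id V (f : {linear V -> V}) n : f =1 id -> tpow_map f n =1 id.
Proof.
by move=> f1; apply: (@tpow_ext _ _ _ _ lid) => v; rewrite tpow_mapE; apply: tpows_ext.
Qed.

Lemma trot_tpow_map V W (f : {linear V -> W}) n x :
  trot W n (tpow_map f n x) = tpow_map f n (trot V n x).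
Proof.
rewrite -[LHS]/((trot W n ∘ tpow_map f n) x).
rewrite -[RHS]/((tpow_map f n ∘ trot V n) x); move: x.
apply: tpow_ext => v; rewrite !lcompE trotE !tpow_mapE trotE.
by apply: tpows_ext => -[].
Qed.

(** On the underlying 2(n+1) legs, [relink] rotates by one place and the rotation of pairs by two;
    powers of one rotation commute. *)
Lemma trot_relink V n x :
  trot (V ⊗ V)%type n (relink V n x) = relink V n (trot _ n x).
Proof.
rewrite -[LHS]/((trot _ n ∘ relink V n) x).
rewrite -[RHS]/((relink V n ∘ trot _ n) x); move: x.
apply: tpow_tens_ext => v w; rewrite [LHS]lcompE relinkE [RHS]lcompE !trotE.
pose v' i := if i is j.+1 then v j else v n.
pose w' i := if i is j.+1 then w j else w n.
transitivity (relink V n (tpows (fun i => v' i \ot w' i) n)).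
  by rewrite relinkE; case: n @v' @w' => [|n] v' w' //; apply: tpows_ext => -[|[|i]].
by congr (relink V n _); apply: tpows_ext => -[].
Qed.

Definition head_map V (f : {linear V -> V}) n : {linear tpow V n -> tpow V n} :=
  match n with 0 => f | n'.+1 => tmap f lid end.

Lemma head_mapE V (f : {linear V -> V}) v n :
  head_map f n (tpows v n) = tpows (fun i => if i is 0 then f (v 0) else v i) n.
Proof. by case: n => [|n] //; rewrite /= tmapE. Qed.

(* f acts on every factor as the (n+1)-st power of head_map f n ∘ trot V n. *)
Lemma tpow_map_fixed V (f : {linear V -> V}) n x :
  trot V n x = x -> head_map f n x = x -> tpow_map f n x = x.
Proof.
move=> tx fx; pose step := head_map f n ∘ trot V n.
have stepx : step x = x by rewrite lcompE tx.
pose iters := fix iters j : {linear tpow V n -> tpow V n} :=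
  if j is j'.+1 then step ∘ iters j' else lid.
have itersx j : iters j x = x by elim: j => //= j ->.
rewrite -[X in _ = X](itersx n.+1); move: {tx fx stepx itersx} x.
(* After [j] steps the last [j] factors have come to the front, each hit by [f] exactly once; the
   index is i - j modulo n+1, so a full turn restores the order. *)
suff itersE j v : (j <= n.+1)%N -> iters j (tpows v n) =
    tpows (fun i => if (i < j)%N then f (v (n.+1 + i - j)%N) else v (i - j)%N) n.
  apply: tpow_ext => v; rewrite tpow_mapE itersE //.
  by apply: tpows_ext => i ilen; rewrite ltnS ilen addnC addnK.
elim: j => [|j IH] jn.
  transitivity (tpows v n) => //.
  by apply: tpows_ext => i _; rewrite ltn0 subn0.
transitivity (step (iters j (tpows v n))) => //.
rewrite IH ?(ltnW jn) // lcompE trotE head_mapE.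
apply: tpows_ext => -[|i] _.
  rewrite ltnNge (ltnSE jn) /= addn0 subSS; congr (f (v _)).
by rewrite ltnS addnS !subSS.
Qed.

End TensorPowers.

(** * The cyclic bicomplex on invariant chains *)

Section CyclicInvariants.
Variables (k : fieldType) (R : nualg k).

(** Strictness of the bound keeps the last factor, which the rotation brings to the front, out of
    the product. *)
Lemma face_trot n i (x : tpow R n.+1) : (i < n)%N ->
  face R i.+1 n (trot R n.+1 x) = trot R n (face R i n x).
Proof.
move=> i_n; rewrite -[LHS]/((face R i.+1 n ∘ trot R n.+1) x).
rewrite -[RHS]/((trot R n ∘ face R i n) x); move: x.
apply: tpow_ext => v; rewrite [LHS]lcompE [RHS]lcompE.
rewrite trotE !faceE ?(ltnW i_n) // trotE.
apply: tpows_ext => -[|j] _.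
  by rewrite [(n < i)%N]ltnNge (ltnW i_n) /= gtn_eqF.
by rewrite ltnS eqSS; case: ltngtP => // ->.
Qed.

Variable x : forall m, tpow R m.
Hypotheses (face0_x : forall m, face R 0 m (x m.+1) = x m)
  (trot_x : forall m, trot R m (x m) = x m).

(** Rotation invariance transports each face to the next one. *)
Lemma face_invariant i m : (i <= m)%N -> face R i m (x m.+1) = x m.
Proof.
elim: i => [|i IH] im; first exact: face0_x.
by rewrite -[x m.+1]trot_x face_trot // IH ?trot_x // ltnW.
Qed.

Lemma hoch_bp_invariant m : hoch_bp R m (x m.+1) = (~~ odd m)%:R *: x m.
Proof.
rewrite mklinE /hoch_bp_fun.
under eq_bigr => i _ do rewrite face_invariant ?leq_ord //.
rewrite -scaler_suml; congr (_ *: _).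
elim: m => [|m IH]; first by rewrite big_ord1.
rewrite big_ord_recr /= IH -signr_odd /=.
by case: odd; rewrite /= ?expr1 ?expr0 ?subrr ?add0r.
Qed.

(** The wrap-around face adds one more term of the alternating sum, which exchanges the two parities
    of [hoch_bp_invariant]. *)
Lemma hoch_b_invariant m : hoch_b R m (x m.+1) = (odd m)%:R *: x m.
Proof.
rewrite mklinE /hoch_b_fun -[hoch_bp_fun _]/(hoch_bp R m _) hoch_bp_invariant.
rewrite trot_x face0_x -scalerDl -signr_odd /=.
by case: odd; rewrite /= ?expr1 ?expr0 ?subrr ?add0r.
Qed.

Lemma cyc_t_invariant m : cyc_t R m (x m) = (-1) ^+ m *: x m.
Proof. by rewrite mklinE /cyc_t_fun trot_x. Qed.

Lemma cyc_N_invariant m : cyc_N R m (x m) = (~~ odd m * m.+1)%:R *: x m.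
Proof.
rewrite mklinE /cyc_N_fun.
have iterE i : iter i (@cyc_t_fun _ R m) (x m) = (-1) ^+ (m * i) *: x m.
  elim: i => [|i IH]; first by rewrite muln0 scale1r.
  rewrite iterS IH -[cyc_t_fun _]/(cyc_t R m _) linearZ /= cyc_t_invariant scalerA.
  by rewrite -exprD mulnS addnC.
under eq_bigr => i _ do rewrite iterE exprM -signr_odd.
rewrite -scaler_suml; congr (_ *: _).
case: (boolP (odd m)) => m_odd; last first.
  rewrite mul1n -[RHS]/(1 *+ m.+1) -[m.+1 in RHS]card_ord -sumr_const.
  by apply: eq_bigr => i _; rewrite expr1n.
(* For [m] odd the m+1 signs alternate and pair off. *)
have sum0 j : \sum_(i < j.*2) (-1) ^+ i = 0 :> k.
  elim: j => [|j IH]; first by rewrite big_ord0.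
  by rewrite doubleS !big_ord_recr /= IH add0r exprS mulN1r subrr.
rewrite mul0n -[RHS](sum0 (m.+1)./2); by rewrite even_halfK //= m_odd.
Qed.

Let half_le m : (m./2 <= m)%N.
Proof. by rewrite leq_half_double -addnn -addnS leq_addr. Qed.

Let fact_half_dvd m : (m./2`! %| m`!)%N.
Proof. by rewrite -(bin_fact (half_le m)) mulnCA dvdn_mulr. Qed.

Lemma chw_coef_even m : ~~ odd m ->
  (m.+1`! %/ (m.+1)./2`! = m.+1 * (m`! %/ m./2`!))%N.
Proof.
move=> m_even; rewrite -[(m.+1)./2]/(uphalf m) uphalf_half (negbTE m_even).
by rewrite add0n factS muln_divA // fact_half_dvd.
Qed.

(** The numerator gains the factor m+1 and the denominator half of it. *)
Lemma chw_coef_odd m : odd m ->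
  (m.+1`! %/ (m.+1)./2`! = 2 * (m`! %/ m./2`!))%N.
Proof.
move=> m_odd; rewrite -[(m.+1)./2]/(uphalf m) uphalf_half m_odd add1n.
apply/eqP; rewrite eq_sym eqn_div ?fact_gt0 //; last first.
  by have := fact_half_dvd m.+1; rewrite /= uphalf_half m_odd add1n.
have m1E : m.+1 = (2 * (m./2).+1)%N.
  by rewrite mul2n doubleS -[in LHS](odd_double_half m) m_odd.
by rewrite [in X in _ == X]factS m1E factS mulnACA divnK ?fact_half_dvd // mulnCA.
Qed.

(** The parity hypothesis says that the source has even total degree. There the column always
    selects the differential that does not vanish on [x]. *)
Lemma vert_invariant p m : odd p = ~~ odd m ->
  vert R p m (x m.+1) = (if odd m then 1 else - 1) *: x m.
Proof.
rewrite /vert => ->; case: (boolP (odd m)) => m_odd /=.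
  by rewrite -[LHS]/(hoch_b R m _) hoch_b_invariant m_odd.
by rewrite -[linfn _ _]/(hoch_bp R m _) hoch_bp_invariant m_odd scaleN1r scale1r.
Qed.

Lemma horiz_invariant p m : odd p = odd m ->
  horiz R p m (x m) = (if odd m then 2 else m.+1)%:R *: x m.
Proof.
rewrite /horiz => ->; case: (boolP (odd m)) => m_odd /=.
  rewrite -[linfn _ _]/(cyc_t R m _) cyc_t_invariant -signr_odd m_odd.
  by rewrite scaleN1r opprK scaler_nat.
by rewrite -[LHS]/(cyc_N R m _) cyc_N_invariant m_odd mul1n.
Qed.

(* With a_m the coefficients of chw, a_(m+1) = (m + 1) a_m for m even and
   a_(m+1) = - 2 a_m for m odd: the vertical terms cancel the horizontal ones. *)
Lemma chw_cycle n : tot_d n.*2 (chw x n) = 0.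
Proof.
case: n => [|n] //.
apply/ffunP => m; rewrite mklinE /tot_dS_fun !ffunE linearZ [X in _ + X]linearZ /=.
have m_le : (m <= n.*2.+1)%N by rewrite -ltnS ltn_ord.
have p_odd : odd (n.*2.+1 - m) = ~~ odd m by rewrite oddB //= odd_double.
rewrite vert_invariant // horiz_invariant /= ?p_odd ?negbK // !scalerA -scalerDl.
rewrite [X in X *: _](_ : _ = 0) ?scale0r // -[uphalf m]/(m.+1)./2.
case: (boolP (odd m)) => m_odd.
  rewrite chw_coef_odd // -[(m.+1)./2]/(uphalf m) uphalf_half m_odd add1n exprS.
  by rewrite natrM mulN1r mulr1 mulNr mulrCA mulrC addNr.
rewrite chw_coef_even // -[(m.+1)./2]/(uphalf m) uphalf_half (negbTE m_odd).
by rewrite natrM mulrN1 mulrCA mulrC addNr.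
Qed.

Lemma Stot_chw n : Stot R n.*2 (chw x n.+1) = chw x n.
Proof. by apply/ffunP => m; rewrite mklinE /Stot_fun !ffunE. Qed.

End CyclicInvariants.

Section FaceNatural.
Variables (k : fieldType) (R S : nualg k) (f : {linear R -> S}).
Hypothesis fM : forall x y, f (na_mul R (x \ot y)) = na_mul S (f x \ot f y).

Lemma tpow_map_face i n (x : tpow R n.+1) : (i <= n)%N ->
  tpow_map f n (face R i n x) = face S i n (tpow_map f n.+1 x).
Proof.
move=> i_n; rewrite -[LHS]/((tpow_map f n ∘ face R i n) x).
rewrite -[RHS]/((face S i n ∘ tpow_map f n.+1) x); move: x.
apply: tpow_ext => v; rewrite [LHS]lcompE [RHS]lcompE tpow_mapE !faceE // tpow_mapE.
by apply: tpows_ext => j _; case: ifP => // _; case: ifP => // /eqP->.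
Qed.

End FaceNatural.

(** * Iterated comultiplications and faces of the Chern character *)

Section HeadMap.
Variable k : fieldType.
Implicit Types V : lmodType k.

(** The head factor is the linear variable and the tail is frozen, so that identities about the head
    can be checked by extensionality. *)
Definition tcons V (v : nat -> V) n : {linear V -> tpow V n} :=
  match n with 0 => lid | n'.+1 => tpurer V (tpows v n') end.

Lemma tcons_tpows V (v : nat -> V) n : tpows v n = tcons (fun i => v i.+1) n (v 0).
Proof. by case: n. Qed.

Lemma head_map_tcons V (f : {linear V -> V}) v n a :
  head_map f n (tcons v n a) = tcons v n (f a).
Proof. by case: n => [|n] //; rewrite /= tmapE. Qed.

End HeadMap.

Section Comultiplication.
Variables (k : fieldType) (C : coalgebra k).

Lemma icomulS n c : icomul C n.+1 c = tmap lid (icomul C n) (comul C c).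
Proof. by []. Qed.

(** By coassociativity the last leg of the iterated coproduct is [c_(2)], the other legs being those
    of [c_(1)]. *)
Lemma trot_icomul n c :
  trot C n.+1 (icomul C n.+1 c) = tmap lid (icomul C n) (tswap (comul C c)).
Proof.
elim: n c => [|n IH] c; first by rewrite -tmap_swap.
(* [F] is the inductive rotation: the tail is rotated as the induction hypothesis prescribes, then
   its new head jumps over the first leg. *)
pose F := tassoc ∘ tmap tswap lid ∘ tassocV ∘
  tmap (@lid k C) (tmap lid (icomul C n) ∘ @tswap k C C).
transitivity (F (tmap lid (comul C) (comul C c))).
  rewrite icomulS.
  transitivity (tassoc (tmap tswap lid (tassocV (tmap lid (trot C n.+1)
    (tmap lid (icomul C n.+1) (comul C c)))))) => //.
  do 3!congr (_ _); rewrite !tmap_comp; apply: eq_tmap => //.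
rewrite -comulA.
rewrite -[LHS]/((F ∘ tassoc ∘ tmap (comul C) lid) (comul C c)).
rewrite -[RHS]/((tmap lid (icomul C n.+1) ∘ tswap) (comul C c)).
move: (comul C c); apply: tens_ext => a b.
rewrite !lcompE tmapE tswapE tmapE icomulS lidE.
rewrite -[LHS]/((F ∘ tassoc ∘ tpurer _ b) (comul C a)).
rewrite -[RHS]/((tpurel _ b ∘ tmap lid (icomul C n)) (comul C a)).
move: (comul C a); apply: tens_ext => a1 a2.
by rewrite !lcompE tpurerE tassocE !(tmapE, lcompE, tswapE, tassocVE, tassocE).
Qed.

Lemma trot_icomul_tr n c : Ctr c -> trot C n (icomul C n c) = icomul C n c.
Proof. by case: n => // n hc; rewrite trot_icomul hc. Qed.

End Comultiplication.

Section PairAlgebra.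
Variables (k : fieldType) (A : algType k).

Definition pair_mul : {linear ((A ⊗ A) ⊗ (A ⊗ A))%type -> (A ⊗ A)%type} :=
  tmap (tmul A) lid ∘ tassocV ∘ tmap (tmul A) lid.

Lemma pair_mulE x y : pair_mul (x \ot y) = tmap (lmul (tmul A x)) lid y.
Proof.
rewrite -[LHS]/((pair_mul ∘ tpurel _ x) y); move: y; apply: tens_ext => a b.
by rewrite lcompE tpurelE !lcompE tmapE tassocVE !tmapE tmulE.
Qed.

Lemma tmul_lmul a (x : (A ⊗ A)%type) : tmul A (tmap (lmul a) lid x) = a * tmul A x.
Proof.
rewrite -[LHS]/((tmul A ∘ tmap (lmul a) lid) x).
rewrite -[RHS]/((lmul a ∘ tmul A) x); move: x.
by apply: tens_ext => u v; rewrite lcompE tmapE [RHS]lcompE !tmulE !lmulE mulrA.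
Qed.

Lemma pair_mulA x y z :
  pair_mul (pair_mul (x \ot y) \ot z) = pair_mul (x \ot pair_mul (y \ot z)).
Proof.
rewrite !pair_mulE tmul_lmul tmap_comp; apply: eq_tmap => // u.
by rewrite lcompE !lmulE mulrA.
Qed.

(* A ⊗ A with (a ⊗ a')(b ⊗ b') = a a' b ⊗ b', which contains A □^C A as a
   subalgebra *)
Definition pair_alg : nualg k := NUAlg pair_mulA.

(** [relink] puts the two legs of [u] into the two leading factors, where the product joins them
    again into the scalar [s]. *)
Lemma face0_relink n u y (s : k) : tmul A u = s *: 1 ->
  face pair_alg 0 n (relink A n.+1 (u \ot y)) = s *: relink A n y.
Proof.
move=> us; rewrite -linearZ.
rewrite -[LHS]/((face pair_alg 0 n ∘ relink A n.+1 ∘ tpurel _ u) y).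
rewrite -[RHS]/((relink A n ∘ (s \*: lid)) y); move: y.
apply: tpow_tens_ext => v w.
transitivity ((tcons (fun i => w i \ot v i.+1) n ∘ tpurer _ (v 0) ∘ lmul (w n)
    ∘ tmul A) u).
  rewrite -[LHS]/((face pair_alg 0 n ∘ relink A n.+1 ∘ tpurer _ (tpows _ n)) u).
  move: u {us}; apply: tens_ext => v0 w0.
  rewrite lcompE tpurerE [RHS]lcompE.
  pose v' i := if i is j.+1 then v j else v0.
  pose w' i := if i is j.+1 then w j else w0.
  rewrite -[_ \ot tpows _ n]/(tpows (fun i => v' i \ot w' i) n.+1).
  rewrite lcompE relinkE (@faceE _ pair_alg) // tcons_tpows !lcompE tpurerE lmulE tmulE.
  by rewrite !(tmapE, tassocVE, tmulE) mulrA.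
rewrite !lcompE us lmulE -scalerAr mulr1 tpurerE.
rewrite -[RHS]/(relink A n (s *: _)) [RHS]linearZ relinkE tcons_tpows /= -linearZ.
by congr (tcons _ _ _); rewrite -[LHS]/(tpurer _ _ _) linearZ.
Qed.

End PairAlgebra.

Section Chern.
Variables (k : fieldType) (C : coalgebra k) (A : algType k).
Variable l : {linear C -> (A ⊗ A)%type}.

Lemma trot_chern m c : Ctr c -> trot _ m (chern l m c) = chern l m c.
Proof. by move=> hc; rewrite /chern trot_relink trot_tpow_map trot_icomul_tr. Qed.

(** The face contracts ℓ(c_(1)) to the counit of [c_(1)], which shortens the iterated coproduct by
    one leg. *)
Lemma face0_chern m c : (forall d, tmul A (l d) = (counit C d : k) *: 1) ->
  face (pair_alg A) 0 m (chern l m.+1 c) = chern l m c.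
Proof.
move=> l_unit; rewrite -[in RHS](counitl c) /chern icomulS.
pose Y := tpow_map l m ∘ icomul C m.
rewrite -[tpow_map l m.+1 _]/(tmap l (tpow_map l m) _) tmap_comp.
rewrite (@eq_tmap _ _ _ _ _ (l ∘ lid) l (tpow_map l m ∘ icomul C m) Y) //.
rewrite -[LHS]/((face (pair_alg A) 0 m ∘ relink A m.+1 ∘ tmap l Y) (comul C c)).
rewrite -[RHS]/((relink A m ∘ Y ∘ tscalel ∘ tmap (counit C) lid) (comul C c)).
move: (comul C c); apply: tens_ext => a b.
rewrite lcompE tmapE [LHS]lcompE (face0_relink _ (l_unit a)).
by rewrite [RHS]lcompE tmapE [RHS]lcompE tscalelE [RHS]linearZ.
Qed.

End Chern.

(** * The Chern character lies over the cotensor product *)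

Lemma tassocK (k : fieldType) (U V W : lmodType k) :
  cancel (@tassoc k U V W) tassocV.
Proof.
move=> x; rewrite -[LHS]/((tassocV ∘ tassoc) x) -[RHS]/(lid x); move: x.
apply: tens_ext => y w.
rewrite -[LHS]/((tassocV ∘ tassoc ∘ tpurer _ w) y) -[RHS]/(tpurer _ w y); move: y.
by apply: tens_ext => u v; rewrite !lcompE tpurerE tassocE tassocVE.
Qed.

Section HeadCoactions.
Variables (k : fieldType) (C : coalgebra k) (A : lmodType k).
Variables (rho : {linear A -> (A ⊗ C)%type}) (lam : {linear A -> (C ⊗ A)%type}).

Lemma eq_tcons (V : lmodType k) (v v' : nat -> V) n a : (forall i, (i < n)%N -> v i = v' i) ->
  tcons v n a = tcons v' n a.
Proof.
by case: n => [|n] vv' //; congr (_ \ot _); apply: tpows_ext => i /vv'.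
Qed.

(* lead brings the left coaction of the first leg of the tensor to the front,
   trail the right coaction of the last leg. After relink these two legs form
   the head factor, whose cotensor condition thus says that lead and trail
   agree. *)
Definition lead n : {linear tpow (A ⊗ A)%type n -> (C ⊗ tpow (A ⊗ A)%type n)%type} :=
  match n with
  | 0 => tassoc ∘ tmap lam lid
  | n'.+1 => tassoc ∘ tmap (tassoc ∘ tmap lam lid) lid
  end.

Fixpoint trail n : {linear tpow (A ⊗ A)%type n -> (C ⊗ tpow (A ⊗ A)%type n)%type} :=
  match n with
  | 0 => tswap ∘ tassocV ∘ tmap lid rho
  | n'.+1 => tassoc ∘ tmap tswap lid ∘ tassocV ∘ tmap lid (trail n')
  end.

(** Since [rho (w n)] need not be a pure tensor, the result is recorded as a linear map [T] known on
    pure tensors. *)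
Lemma trailE (v w : nat -> A) n :
  exists2 T : {linear (A ⊗ C)%type -> (C ⊗ tpow (A ⊗ A)%type n)%type},
    forall a d, T (a \ot d) =
      d \ot tpows (fun i => v i \ot (if i == n then a else w i)) n
  & trail n (tpows (fun i => v i \ot w i) n) = T (rho (w n)).
Proof.
elim: n v w => [|n IH] v w.
  exists (tswap ∘ tassocV ∘ tpurel _ (v 0)) => [a d|].
    by rewrite !lcompE tpurelE tassocVE tswapE.
  by rewrite [LHS]lcompE lcompE tmapE.
have [T TE E] := IH (fun i => v i.+1) (fun i => w i.+1).
exists (tassoc ∘ tmap tswap lid ∘ tassocV ∘ tpurel _ (v 0 \ot w 0) ∘ T) => [a d|].
  by rewrite lcompE TE !lcompE tpurelE tassocVE tmapE tswapE tassocE.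
transitivity (tassoc (tmap tswap lid (tassocV (tmap lid (trail n)
  ((v 0 \ot w 0) \ot tpows (fun i => v i.+1 \ot w i.+1) n))))) => //.
by rewrite tmapE E.
Qed.

Definition inner : {linear (C ⊗ (A ⊗ A))%type -> (A ⊗ (C ⊗ A))%type} :=
  tassoc ∘ tmap tswap lid ∘ tassocV.

Lemma innerE d a b : inner (d \ot (a \ot b)) = a \ot (d \ot b).
Proof. by rewrite !lcompE tassocVE tmapE tswapE tassocE. Qed.

Variable s : {linear (A ⊗ (C ⊗ A))%type -> (A ⊗ A)%type}.

(** A leg in [C] standing in front is put between the legs of the head factor. Composing with [s]
    returns to [A ⊗ A], as [head_map] needs endomorphisms. *)
Definition absorb n : {linear (C ⊗ tpow (A ⊗ A)%type n)%type -> tpow (A ⊗ A)%type n} :=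
  match n with
  | 0 => s ∘ inner
  | n'.+1 => tmap (s ∘ inner) lid ∘ tassocV
  end.

Lemma absorbE n d v a b :
  absorb n (d \ot tcons v n (a \ot b)) = tcons v n (s (a \ot (d \ot b))).
Proof.
case: n => [|n]; first by rewrite lcompE innerE.
by rewrite lcompE tassocVE tmapE lcompE innerE.
Qed.

Lemma relink_tcons (v w : nat -> A) n :
  relink A n (tpows (fun i => v i \ot w i) n) =
  tcons (fun i => w i \ot v i.+1) n (w n \ot v 0).
Proof. by rewrite relinkE tcons_tpows. Qed.

(** The first leg of the relinked head factor is the last leg of [y], whose coaction is what [trail]
    extracts. *)
Lemma head_map_coactr n y :
  head_map (s ∘ (tassoc ∘ tmap rho lid)) n (relink A n y) =
  absorb n (tmap lid (relink A n) (trail n y)).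
Proof.
rewrite -[LHS]/((head_map (s ∘ (tassoc ∘ tmap rho lid)) n ∘ relink A n) y).
rewrite -[RHS]/((absorb n ∘ tmap lid (relink A n) ∘ trail n) y); move: y.
apply: tpow_tens_ext => v w.
rewrite [LHS]lcompE relink_tcons head_map_tcons [RHS]lcompE.
have [T TE ->] := trailE v w n.
rewrite -[(s ∘ _) _]/(s (tassoc (tmap rho lid (w n \ot v 0)))) tmapE.
move: (rho (w n)) => z.
rewrite -[LHS]/((tcons (fun i => w i \ot v i.+1) n ∘ s ∘ tassoc ∘ tpurer _ (v 0)) z).
rewrite -[RHS]/((absorb n ∘ tmap lid (relink A n) ∘ T) z).
move: z; apply: tens_ext => a d.
rewrite [LHS]lcompE tpurerE [LHS]lcompE tassocE.
rewrite [RHS]lcompE TE [RHS]lcompE tmapE relink_tcons eqxx absorbE.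
(* The modified leg has index [n] and occurs only in the head, not in the tail. *)
by apply: eq_tcons => i i_n; rewrite ltn_eqF.
Qed.

Lemma head_map_coactl n y :
  head_map (s ∘ tmap lid lam) n (relink A n y) =
  absorb n (tmap lid (relink A n) (lead n y)).
Proof.
rewrite -[LHS]/((head_map (s ∘ tmap lid lam) n ∘ relink A n) y).
rewrite -[RHS]/((absorb n ∘ tmap lid (relink A n) ∘ lead n) y); move: y.
apply: tpow_tens_ext => v w.
rewrite [LHS]lcompE relink_tcons head_map_tcons [RHS]lcompE.
rewrite -[(s ∘ _) _]/(s (tmap lid lam (w n \ot v 0))) tmapE.
have [T TE ->] : exists2 T : {linear (C ⊗ A)%type -> (C ⊗ tpow (A ⊗ A)%type n)%type},
    forall d a, T (d \ot a) =
      d \ot tpows (fun i => (if i is 0 then a else v i) \ot w i) n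
  & lead n (tpows (fun i => v i \ot w i) n) = T (lam (v 0)).
  case: n => [|n].
    exists (tassoc ∘ tpurer _ (w 0)) => [d a|]; first by rewrite lcompE tassocE.
    by rewrite lcompE tmapE.
  pose t := tpows (fun i => v i.+1 \ot w i.+1) n.
  exists (tassoc ∘ tpurer _ t ∘ tassoc ∘ tpurer _ (w 0)) => [d a|].
    by rewrite lcompE tpurerE lcompE tassocE lcompE tpurerE tassocE.
  by rewrite [LHS]lcompE tmapE [in LHS]lcompE tmapE.
move: (lam (v 0)) => z.
rewrite -[LHS]/((tcons (fun i => w i \ot v i.+1) n ∘ s ∘ tpurel _ (w n)) z).
rewrite -[RHS]/((absorb n ∘ tmap lid (relink A n) ∘ T) z).
move: z; apply: tens_ext => d a.
rewrite [LHS]lcompE tpurelE [LHS]lcompE.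
by rewrite [RHS]lcompE TE [RHS]lcompE tmapE relink_tcons absorbE.
Qed.

Variable l : {linear C -> (A ⊗ A)%type}.
Hypotheses (l_left : forall c, tassoc (tmap lam lid (l c)) = tmap lid l (comul C c))
  (l_right : forall c, tmap lid rho (l c) = tassoc (tmap l lid (comul C c))).

(** Left colinearity of ℓ on the first factor, followed by coassociativity, splits off the first leg
    of the coproduct. *)
Lemma lead_colinear n c :
  lead n (tpow_map l n (icomul C n c)) =
  tmap lid (tpow_map l n ∘ icomul C n) (comul C c).
Proof.
case: n => [|n].
  by rewrite [LHS]lcompE l_left; apply: eq_tmap.
pose Y := tpow_map l n ∘ icomul C n.
transitivity (tassoc (tmap (tmap lid l) Y (tmap (comul C) lid (comul C c)))).
  rewrite icomulS [LHS]lcompE -[tpow_map l _ _]/(tmap l (tpow_map l n) _).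
  rewrite !tmap_comp; congr (tassoc _); apply: eq_tmap => //.
rewrite tmap_assoc comulA tmap_comp; apply: eq_tmap => // d.
rewrite [RHS]lcompE icomulS -[RHS]/(tmap l (tpow_map l n) _) tmap_comp.
by apply: eq_tmap.
Qed.

(** The mirror image of [lead_colinear]: right colinearity on the last factor splits off the last
    leg, with the same induction as in [trot_icomul]. *)
Lemma trail_colinear n c :
  trail n (tpow_map l n (icomul C n c)) =
  tmap lid (tpow_map l n ∘ icomul C n) (tswap (comul C c)).
Proof.
elim: n c => [|n IH] c.
  rewrite [LHS]lcompE [LHS]lcompE l_right tassocK tmap_swap.
  by apply: eq_tmap.
pose Y := tpow_map l n ∘ icomul C n.
pose F := tassoc ∘ tmap tswap lid ∘ tassocV ∘ tmap l (tmap lid Y ∘ @tswap k C C).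
transitivity (F (tmap lid (comul C) (comul C c))).
  rewrite icomulS -[tpow_map l _ _]/(tmap l (tpow_map l n) _).
  rewrite -[LHS]/(tassoc (tmap tswap lid (tassocV (tmap lid (trail n) _)))).
  by do 3!congr (_ _); rewrite !tmap_comp; apply: eq_tmap.
rewrite -comulA.
rewrite -[LHS]/((F ∘ tassoc ∘ tmap (comul C) lid) (comul C c)).
rewrite -[RHS]/((tmap lid (tpow_map l n.+1 ∘ icomul C n.+1) ∘ tswap) (comul C c)).
move: (comul C c); apply: tens_ext => a b.
rewrite [LHS]lcompE tmapE [RHS]lcompE tswapE tmapE [(tpow_map _ _ ∘ _) a]lcompE icomulS.
rewrite -[tpow_map l _ _]/(tmap l (tpow_map l n) _) tmap_comp.
rewrite -[LHS]/((F ∘ tassoc ∘ tpurer _ b) (comul C a)).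
rewrite -[RHS]/((tpurel _ b ∘ tmap (l ∘ lid) Y) (comul C a)).
move: (comul C a); apply: tens_ext => a1 a2.
rewrite [LHS]lcompE tpurerE [LHS]lcompE tassocE [RHS]lcompE tmapE tpurelE.
rewrite -[LHS]/(tassoc (tmap tswap lid (tassocV (tmap l _ (a1 \ot _))))) tmapE.
rewrite -[(_ ∘ _) (a2 \ot b)]/(tmap lid Y (tswap (a2 \ot b))).
by rewrite tswapE tmapE tassocVE tmapE tswapE tassocE.
Qed.

(** The two sides insert opposite legs of the coproduct of [c], which the trace condition
    identifies. *)
Lemma head_map_chern n c : Ctr c ->
  head_map (s ∘ (tassoc ∘ tmap rho lid)) n (chern l n c) =
  head_map (s ∘ tmap lid lam) n (chern l n c).
Proof.
move=> hc; rewrite /chern head_map_coactr head_map_coactl.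
by rewrite lead_colinear trail_colinear hc.
Qed.

End HeadCoactions.

Lemma head_mapB (k : fieldType) (V : lmodType k) (p f g : {linear V -> V}) n x :
  (forall v, p v = v - (f v - g v)) ->
  head_map p n x = x - (head_map f n x - head_map g n x).
Proof.
move=> pE; rewrite -[RHS]/((lid \- (head_map f n \- head_map g n)) x).
move: x; apply: tpow_ext => v.
rewrite -[RHS]/(tpows v n - (head_map f n (tpows v n) - head_map g n (tpows v n))).
by rewrite tcons_tpows !head_map_tcons pE !linearB.
Qed.

(* P := id - s (f - g) is a projection onto the equalizer of f and g as soon as
   s is a generalized inverse of f - g. *)
Lemma equalizer_retraction (k : fieldType) (V W : lmodType k)
    (f g : {linear V -> W}) :
  exists (r : {linear V -> equalizer f g}) (s : {linear W -> V}),
    cancel (eqz_incl f g) r /\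
    forall v, eqz_incl f g (r v) = v - (s (f v) - s (g v)).
Proof.
have [s hs] := lin_ginv [the {linear V -> W} of f \- g].
pose p := [the {linear V -> V} of lid \- (lcomp s f \- lcomp s g)].
have hp v : f (p v) = g (p v).
  apply/eqP; rewrite -subr_eq0 -[_ - _]/((f \- g) (p v)).
  have -> : p v = v - s ((f \- g) v) by rewrite [in RHS]linearB.
  by rewrite [X in X == _]linearB [X in _ - X]hs subrr.
have r_lin : linear (fun v => eqz_mk (hp v)).
  by move=> a u v; apply: val_inj; rewrite [RHS]linearP; apply: (linearP p).
exists (mklin r_lin), s; split=> // y; apply: val_inj.
by rewrite -[LHS]/(val y - (s (f (val y)) - s (g (val y)))) equalizerP subrr subr0.
Qed.

(** * Strong connections and assembly of the cycle *)

Section StrongConnection.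
Variables (k : fieldType) (C : coalgebra k) (e : C) (A : extension e).
Hypotheses (can_bij : bijective (can A)) (psi_bij : bijective (psi can_bij)).
Variable l : {linear C -> (A ⊗ A)%type}.
Hypothesis hl : strong_connection psi_bij l.

Lemma tscaler_can x : tscaler (tmap lid (counit C) (can A (piB A x))) = tmul A x.
Proof.
rewrite -[LHS]/((tscaler ∘ tmap lid (counit C) ∘ can A ∘ piB A) x); move: x.
apply: tens_ext => a a'; rewrite lcompE lcompE canE tmulE -[in RHS](coact_counit a').
rewrite -[LHS]/((tscaler ∘ tmap lid (counit C) ∘ tmap (lmul a) lid) (coact A a')).
rewrite -[RHS]/((lmul a ∘ tscaler ∘ tmap lid (counit C)) (coact A a')).
move: (coact A a'); apply: tens_ext => u d.
by rewrite lcompE tmapE lcompE tmapE tscalerE lcompE tmapE lcompE tscalerE linearZ.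
Qed.

(** The counit turns [can] into multiplication, and [can] sends the class of ℓ(d) to [1 ⊗ d]. *)
Lemma tmul_strong_connection d : tmul A (l d) = (counit C d : k) *: 1.
Proof.
have [_ _ _ lift_l] := hl.
by rewrite -tscaler_can lift_l can_translK tmapE tscalerE.
Qed.

Lemma cotens_incl_mul x y : cotens_incl psi_bij (na_mul (cotens_alg psi_bij) (x \ot y)) =
  na_mul (pair_alg A) (cotens_incl psi_bij x \ot cotens_incl psi_bij y).
Proof.
by rewrite [X in cotens_incl _ X = _]cotens_mulE cotens_mul_incl [RHS]pair_mulE.
Qed.

End StrongConnection.

Theorem theorem4p5 (k : fieldType) (C : coalgebra k) (e : C)
    (he : grouplike e) (A : extension e)
    (can_bij : bijective (can A)) (psi_bij : bijective (psi can_bij))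
    (l : {linear C -> A ⊗ A}) (hl : strong_connection psi_bij l)
    (c : C) (hc : Ctr c) :
  exists x : forall m, tpow (cotens_alg psi_bij) m,
    (forall m,
      unique (fun y => tpow_map (cotens_incl psi_bij) m y = chern l m c) (x m))
    /\ exists hcyc : forall n, tot_d n.*2 (chw x n) = 0,
         forall n, HC_S (n := n.*2) (HC_class (hcyc n.+1)) = HC_class (hcyc n).
Proof.
have [r [s [incl_r r_incl]]] := equalizer_retraction
  (tassoc ∘ tmap (coact A) lid) (tmap lid (lcoact psi_bij)).
pose incl := cotens_incl psi_bij.
pose x m : tpow (cotens_alg psi_bij) m := tpow_map r m (chern l m c).
have [_ l_left l_right _] := hl.
have inclK m : cancel (tpow_map incl m) (tpow_map r m).
  by move=> y; rewrite tpow_map_comp; apply: tpow_map_id.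
have x_chern m : tpow_map incl m (x m) = chern l m c.
  (* It suffices that the projection [incl ∘ r] fixes the head, where it subtracts the defect of the
     cotensor condition. *)
  rewrite /x tpow_map_comp tpow_map_fixed ?trot_chern //.
  rewrite (@head_mapB _ _ (incl ∘ r) (s ∘ (tassoc ∘ tmap (coact A) lid))
    (s ∘ tmap lid (lcoact psi_bij)) _ _ r_incl).
  by rewrite (head_map_chern s l_left l_right) // subrr subr0.
have trot_x m : trot _ m (x m) = x m by rewrite /x trot_tpow_map trot_chern.
have face0_x m : face (cotens_alg psi_bij) 0 m (x m.+1) = x m.
  (* Faces can be compared over [A ⊗ A]: the inclusion is multiplicative and injective on tensor
     powers. *)
  apply: (can_inj (inclK m)); rewrite x_chern.
  rewrite (@tpow_map_face _ (cotens_alg psi_bij) (pair_alg A) incl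
    (@cotens_incl_mul _ _ _ _ _ psi_bij)) // x_chern.
  by rewrite face0_chern //; apply: tmul_strong_connection hl.
exists x; split=> [m|]; first by split=> // y y_chern; rewrite /x -y_chern inclK.
exists (chw_cycle face0_x trot_x) => n.
(* The equality already holds between the representing cycles, without a boundary. *)
have Sx : Stot _ n.*2 (chw x n.+1) = chw x n := Stot_chw x n.
have Sx0 : tot_d n.*2 (Stot _ n.*2 (chw x n.+1)) = 0.
  by rewrite Sx; apply: chw_cycle.
by rewrite (HC_SE _ Sx0); congr (qpi _ _); apply: val_inj.
Qed.
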